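(* Let $s\ge1$ and let $f:[0,\infty)\to[0,\infty)$ be a logarithmically-concave gauge function with property $(R_s)$. Let $\Omega\subset\mathbb R^n$ be a bounded Borel set with $0<H_f(\Omega)<+\infty$, and suppose there are constants $C,D>0$ such that $Cf(r)\le H_f(B(x,r)\cap\Omega)\le Df(r)$ for every $x\in\Omega$ and every $0<r\le \operatorname{diam}(\Omega)$. Let $h(x)=1/f^{-1}(1/x)$ for $x>0$, let $N$ be a positive integer such that $(h'(k))_{k\ge N}$ is nonincreasing, and let $\rho=(h'(k))_{k=N}^\infty$. Then for every positive integer $m$, \[k_\rho(\tau_{\Omega,H_f}\otimes I_m)=m^{1/s}\,k_\rho(\tau_{\Omega,H_f}).\]
   Context: Gauge functions: a gauge function is an increasing $f:[0,\infty)\to[0,\infty)$ with $f((0,\infty))\subset(0,\infty)$ and $\lim_{t\to0}f(t)=0$. It has property $(R)$ if it is convex, $C^2$, and $f'(0)=0$; then $f$ is invertible and $f^{-1}$ is its compositional inverse. For $s\ge1$ it has property $(R_s)$ if in addition $\lim_{x\to0^+}f(ax)/f(x)=a^s$ for every $a>0$. $f$ is logarithmically concave if $\log f$ is concave on $(0,\infty)$. Hausdorff measure: for $A\subset\mathbb R^n$, $H_f^*(A)=\lim_{r\to0}\inf\{\sum_j f(r_j): A\subset\bigcup_{j=1}^\infty B(x_j,r_j),\ r_j<r\}$, and $H_f$ is its restriction to Borel sets. Norms: for a nonincreasing sequence $\pi=(\pi_j)_{j\ge1}$ with $\pi_j\to0$, $\sum_j\pi_j=+\infty$, and a finitely supported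 real sequence $\xi$, put $\Phi_\pi(\xi)=\sum_j\pi_j\xi_j^*$, where $\xi^*$ is the nonincreasing rearrangement of $(|\xi_j|)_j$. On a separable complex Hilbert space $\mathcal H$: for finite rank $F$ with singular values $(s_j)$, $|F|_\pi=\Phi_\pi((s_j))$; for $T\in B(\mathcal H)$, $|T|_\pi=\sup_P|PT|_\pi$ over finite rank projections $P$. The sequence $\rho$ is re-indexed from $1$, so $\Phi_\rho(\xi)=\sum_{j\ge1}h'(N+j-1)\xi_j^*$. Quasicentral modulus: $\mathcal R_1^+$ is the set of positive finite rank contractions on $\mathcal H$, directed by the operator order. For an $n$-tuple $\tau=(T_1,\dots,T_n)$, $[A,\tau]=([A,T_1],\dots,[A,T_n])$ with $[A,T]=AT-TA$, $|\tau|_\pi=\max_i|T_i|_\pi$, and $k_\pi(\tau)=\liminf_{A\in\mathcal R_1^+}|[A,\tau]|_\pi$ (liminf along the directed set). $\tau_{\Omega,\mu}=(T_1,\dots,T_n)$ is multiplication by the coordinate variables on $L^2(\Omega,\mu)$: $(T_jg)(x)=x_jg(x)$. $\tau\otimes I_m=(T_1\otimes I_m,\dots,T_n\otimes I_m)$ acts on $\mathcal H\otimes\mathbb C^m$ (the direct sum of $m$ copies of $\tau$). *)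

(* Defs.v *)
From HB Require Import structures.
From mathcomp Require Import all_boot all_order all_algebra.
From mathcomp Require Import sesquilinear generic_quotient ring_quotient.
From mathcomp Require Import all_classical all_reals all_analysis.
From mathcomp Require Import measurable_realfun complex.
Set Implicit Arguments.
Unset Strict Implicit.
Unset Printing Implicit Defensive.
Import Order.TTheory GRing.Theory Num.Theory.
Import numFieldNormedType.Exports.
Local Open Scope classical_set_scope.
Local Open Scope ring_scope.
Local Open Scope quotient_scope.

Section Gauge.
Variable R : realType.
Implicit Types (f : R -> R) (s : R).

Definition is_gauge f :=
  [/\ {in `[0, +oo[ &, {homo f : x y / x < y}},
      forall x, 0 <= x -> 0 <= f x,
      forall x, 0 < x -> 0 < f x
    & f t @[t --> 0^'+] --> (0 : R)].

Record gauge := Gauge { gauge_fun :> R -> R ; gaugeP : is_gauge gauge_fun }.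

End Gauge.

Section GaugeTheory.
Variables (R : realType) (f : gauge R).

Lemma gauge_ge0 x : 0 <= x -> 0 <= f x.
Proof. by case: (gaugeP f) => _ h _ _; exact: h. Qed.

Lemma gauge_cvg0 : f t @[t --> 0^'+] --> (0 : R).
Proof. by case: (gaugeP f). Qed.

Lemma gauge0 : f 0 = 0.
Proof.
have [fi f0 _ fc] := gaugeP f.
apply/eqP; rewrite eq_le f0// andbT leNgt; apply/negP => f00.
near (0 : R)^'+ => t.
have : f t < f 0.
  near: t; exact: (cvgr_lt _ fc).
have t0 : 0 < t by [].
have f0t : f 0 < f t by apply: fi; rewrite ?in_itv/= ?lexx ?(ltW t0).
by move=> /(lt_trans f0t); rewrite ltxx.
Unshelve. all: by end_near. Qed.

End GaugeTheory.

Section Euclidean.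
Variables (R : realType) (n : nat).
Implicit Types x y : 'rV[R]_n.

Definition enorm x : R := Num.sqrt (\sum_(i < n) x ord0 i ^+ 2).

Definition eball x (r : R) : set 'rV[R]_n := [set y | enorm (y - x) < r].

Definition ediam (A : set 'rV[R]_n) : R :=
  sup [set d | exists x y, [/\ A x, A y & d = enorm (x - y)]].

Definition borelRn := g_sigma_algebraType (@open 'rV[R]_n).
HB.instance Definition _ := Measurable.on borelRn.

Lemma mx_norm_enorm x : `|x| <= enorm x.
Proof.
rewrite [`|x|]mx_normrE; apply/bigmax_leP; split; first exact: sqrtr_ge0.
move=> -[i j] _ /=; rewrite (ord1 i) -sqrtr_sqr ler_sqrt; last first.
  by apply: sumr_ge0 => k _; exact: sqr_ge0.
by rewrite (bigD1 j)//= lerDl sumr_ge0// => k _; exact: sqr_ge0.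
Qed.

End Euclidean.

Section Hausdorff.
Variables (R : realType) (n : nat).
Local Notation E := 'rV[R]_n.
Local Open Scope ereal_scope.
Implicit Types (A B : set E) (r : R).

(* A ball of radius [0] is empty and a gauge vanishes at [0], so finite covers are
   included. *)
Definition ball_cover r A (c : nat -> E * R) :=
  (forall j, 0 <= (c j).2 < r)%R /\ A `<=` \bigcup_j eball (c j).1 (c j).2.

Definition hausdorff_pre (f : R -> R) r A : \bar R :=
  ereal_inf [set \sum_(0 <= j <oo) (f (c j).2)%:E | c in ball_cover r A].

Definition hausdorff (f : R -> R) A : \bar R :=
  lim (hausdorff_pre f r A @[r --> 0^'+]).

Variable f : gauge R.
Local Notation pre := (hausdorff_pre f).

Let fc_ge0 r A c j : ball_cover r A c -> 0 <= (f (c j).2)%:E.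
Proof. by case=> /(_ j)/andP[h _] _; rewrite lee_fin gauge_ge0. Qed.

Lemma hausdorff_pre_ge0 r A : 0 <= pre r A.
Proof.
apply: le_ereal_inf_tmp => _ [c cA <-]; apply: nneseries_ge0 => j _ _.
exact: fc_ge0 cA.
Qed.

Lemma hausdorff_pre_anti A : {in `]0%R, +oo[ &, nonincreasing_fun (pre ^~ A)}.
Proof.
move=> r s _ _ rs; apply/ereal_inf_le_tmp => _ [c [cr cA] <-].
by exists c => //; split => // j; have /andP[-> /lt_le_trans->] := cr j.
Qed.

Lemma hausdorff_pre0 r : (0 < r)%R -> pre r set0 = 0.
Proof.
move=> r0; apply/eqP; rewrite eq_le hausdorff_pre_ge0 andbT.
apply: ereal_inf_lbound; exists (fun=> (0%R, 0%R)).
  by split => [j|//]; rewrite lexx.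
by rewrite eseries0// => j _ _ /=; rewrite gauge0.
Qed.

Lemma hausdorffE A : hausdorff f A = ereal_sup [set pre r A | r in `]0%R, +oo[].
Proof.
apply/cvg_lim => //.
exact: (nonincreasing_at_right_cvge +oo%O _ (@hausdorff_pre_anti A)).
Qed.

Lemma hausdorff_pre_le r A : (0 < r)%R -> pre r A <= hausdorff f A.
Proof.
by move=> r0; rewrite hausdorffE; apply: ereal_sup_ubound; exists r => //=;
  rewrite in_itv/= r0.
Qed.

Lemma hausdorff_pre_subadditive r :  (0 < r)%R -> sigma_subadditive (pre r).
Proof.
move=> r0 A; have [[i ioo]|] := pselect (exists i, pre r (A i) = +oo).
  rewrite (eseries_pinfty _ _ ioo) ?leey// => k _.
  by rewrite -ltNye (lt_le_trans _ (hausdorff_pre_ge0 _ _)).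
rewrite -forallNE => Aoo.
suff add2e (e : {posnum R}) :
    pre r (\bigcup_n A n) <= \sum_(i <oo) pre r (A i) + e%:num%:E.
  by apply/lee_addgt0Pr => _/posnumP[].
rewrite (le_trans _ (epsilon_trick _ _ _))//; last first.
  by move=> k; exact: hausdorff_pre_ge0.
pose P k (c : nat -> E * R) := ball_cover r (A k) c /\
  \sum_(0 <= j <oo) (f (c j).2)%:E <= pre r (A k) + (e%:num / (2 ^ k.+1)%:R)%:E.
have [G PG] : {G : nat -> nat -> E * R & forall k, P k (G k)}.
  apply: (@choice _ _ P) => k; rewrite /P /hausdorff_pre.
  set S := (X in ereal_inf X); move infS : (ereal_inf S) => iS.
  case: iS infS => [x Sx|Soo|Soo].
  - have en1 : (0 < e%:num / (2 ^ k.+1)%:R)%R by [].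
    have /(lb_ereal_inf_adherent en1) : ereal_inf S \is a fin_num by rewrite Sx.
    move=> [y [c cA <-] yS].
    by exists c; split => //; rewrite -Sx; exact/ltW.
  - by have := Aoo k; rewrite /hausdorff_pre Soo.
  - suff : lbound S 0 by move/le_ereal_inf_tmp; rewrite Soo.
    by move=> /= _ [c cA <-]; apply: nneseries_ge0 => j _ _; exact: fc_ge0 cA.
pose w (p : nat * nat) : \bar R := (f (G p.1 p.2).2)%:E.
have w_ge0 p : 0 <= w p by exact: (fc_ge0 _ (PG p.1).1).
apply: (@le_trans _ _ (\esum_(i in setT) w i)).
  apply: ereal_inf_lbound => /=.
  have /card_esym/ppcard_eqP[h] := card_nat2.
  exists (fun j => G (h j).1 (h j).2).
    split => [i|]; first exact: (PG (h i).1).1.1.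
    move=> t [i _] /(PG i).1.2 [j _ ?].
    by exists (h^-1%FUN (i, j)) => //=; rewrite invK ?inE.
  rewrite -(esum_pred_image w _ xpredT) ?[fun=> _]set_true//.
  by rewrite image_eq.
rewrite (_ : esum _ _ = \sum_(0 <= i <oo) \sum_(0 <= j <oo) w (i, j)); last first.
  pose J : nat -> set (nat * nat) := fun i => [set (i, j) | j in setT].
  rewrite (_ : setT = \bigcup_k J k); last first.
    by rewrite predeqE => -[a b]; split => // _; exists a => //; exists b.
  rewrite esum_bigcupT //=; last first.
    apply/trivIsetP => i j _ _ ij.
    rewrite predeqE => -[a b] /=; split => //= -[] [_] _ [<-{a} _].
    by move=> [b' _] [] /esym/eqP; rewrite (negbTE ij).
  rewrite -(image_id [set: nat]) -fun_true esum_pred_image//; last first.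
    by move=> k _; exact: esum_ge0.
  apply: eq_eseriesr => /= j _.
  rewrite -(esum_pred_image w (pair j) predT)//=; last first.
    by move=> ? ? _ _; exact: (@can_inj _ _ _ snd).
  by congr esum; rewrite predeqE => -[a b]; split; move=> [i _ <-]; exists i.
apply: lee_nneseries => [i _ _|i _]; last exact: (PG i).2.
by apply: nneseries_ge0 => j _ _; exact: w_ge0.
Qed.

Lemma hausdorff0 : hausdorff f set0 = 0.
Proof.
rewrite hausdorffE; apply/eqP; rewrite eq_le; apply/andP; split.
  apply: ge_ereal_sup => _ [r + <-]; rewrite /= in_itv/= andbT => r0.
  by rewrite hausdorff_pre0.
by rewrite -hausdorffE -(hausdorff_pre0 ltr01); exact: hausdorff_pre_le.
Qed.

Lemma hausdorff_ge0 A : 0 <= hausdorff f A.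
Proof. exact: le_trans (hausdorff_pre_ge0 _ _) (hausdorff_pre_le A ltr01). Qed.

Lemma le_hausdorff : {homo hausdorff f : A B / A `<=` B >-> A <= B}.
Proof.
move=> A B AB; rewrite hausdorffE; apply: ge_ereal_sup => _ [r + <-].
rewrite /= in_itv/= andbT => r0; apply: le_trans (hausdorff_pre_le _ r0).
by apply/ereal_inf_le_tmp => _ [c [cr cB] <-]; exists c => //; split => // x /AB/cB.
Qed.

Lemma hausdorff_sigma_subadditive : sigma_subadditive (hausdorff f).
Proof.
move=> A; rewrite {1}hausdorffE; apply: ge_ereal_sup => _ [r + <-].
rewrite /= in_itv/= andbT => r0.
apply: (le_trans (hausdorff_pre_subadditive r0 _)).
apply: lee_nneseries => [i _ _|i _]; first exact: hausdorff_pre_ge0.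
exact: hausdorff_pre_le.
Qed.

HB.instance Definition _ := isOuterMeasure.Build R E (hausdorff f)
  hausdorff0 hausdorff_ge0 le_hausdorff hausdorff_sigma_subadditive.

Definition separated (d : R) A B := forall a b, A a -> B b -> (d <= `|a - b|)%R.

Lemma hausdorff_separated d A B : (0 < d)%R -> separated d A B ->
  hausdorff f A + hausdorff f B <= hausdorff f (A `|` B).
Proof.
move=> d0 AB.
have d20 : (0 < d / 2)%R by rewrite divr_gt0.
have key r : (0 < r)%R -> (r <= d / 2)%R -> pre r A + pre r B <= pre r (A `|` B).
  move=> r0 rd; apply: le_ereal_inf_tmp => _ [c [cr cAB] <-].
  pose meets (X : set E) j := `[< eball (c j).1 (c j).2 `&` X !=set0 >].
  pose sub (X : set E) j := if meets X j then c j else ((c j).1, 0%R).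
  have subc X : X `<=` A `|` B -> ball_cover r X (sub X).
    move=> XAB; split => [j|x Xx].
      by rewrite /sub; case: ifP => //= _; rewrite lexx.
    have [j _ xj] := cAB _ (XAB _ Xx); exists j => //.
    by rewrite /sub ifT//; apply/asboolP; exists x.
  have sA := subc A (@subsetUl _ _ _); have sB := subc B (@subsetUr _ _ _).
  have leX X : X `<=` A `|` B -> pre r X <= \sum_(0 <= j <oo) (f (sub X j).2)%:E.
    by move=> XAB; apply: ereal_inf_lbound; exists (sub X) => //; exact: subc.
  apply: (le_trans (leeD (leX A _) (leX B _))) => //.
  rewrite -nneseriesD; last 2 first.
    by move=> j _ _; exact: fc_ge0 sA.
    by move=> j _ _; exact: fc_ge0 sB.
  apply: lee_nneseries => j _.
    by move=> _; rewrite adde_ge0//; [exact: fc_ge0 sA|exact: fc_ge0 sB].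
  have fj : 0 <= (f (c j).2)%:E.
    by have /andP[? _] := cr j; rewrite lee_fin gauge_ge0.
  rewrite /sub; case: ifP => [/asboolP[a [ca Aa]]|_]; last first.
    by case: ifP => _ /=; rewrite gauge0 ?add0e.
  rewrite ifF ?gauge0 ?adde0//; apply/negP => /asboolP[b [cb Bb]].
  have := AB _ _ Aa Bb; apply/negP; rewrite -ltNge.
  have /andP[_ cjr] := cr j.
  have -> : (a - b = (a - (c j).1) - (b - (c j).1))%R by rewrite opprB addrA subrK.
  rewrite (le_lt_trans (ler_normB _ _))// [ltRHS]splitr.
  by rewrite ltrD// (le_lt_trans (mx_norm_enorm _))//;
    [apply: lt_le_trans ca _|apply: lt_le_trans cb _];
    rewrite (le_trans (ltW cjr)).
have cvgA X := nonincreasing_at_right_cvge +oo%O isT (@hausdorff_pre_anti X).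
have {}cvgA X : pre r X @[r --> 0^'+] --> hausdorff f X by rewrite hausdorffE; exact: cvgA.
have ge0 : hausdorff f A +? hausdorff f B by apply: ge0_adde_def; rewrite inE; exact: hausdorff_ge0.
rewrite -(cvg_lim _ (cvgeD ge0 (cvgA A) (cvgA B)))//.
rewrite -(cvg_lim _ (cvgA (A `|` B)))//.
apply: lee_lim => //.
- apply: cvgP; exact: (cvgeD ge0 (cvgA A) (cvgA B)).
- near=> r; apply: key; first by near: r; exact: nbhs_right_gt.
  by near: r; exact: nbhs_right_le.
Unshelve. all: by end_near. Qed.


(* Caratheodory's criterion: U is exhausted by the sets [core U k], each at
   positive distance from the complement of the next one. *)
Let core (U : set E) k := [set x | ball x (k.+1%:R^-1 : R) `<=` U].
Let ring U k := core U k.+1 `\` core U k.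

Let core_le U k l : (k <= l)%N -> core U k `<=` core U l.
Proof.
move=> kl x Ux; apply: subset_trans Ux; apply: le_ball.
by rewrite lef_pV2 ?posrE// ler_nat ltnS.
Qed.

Let gap (k : nat) : R := (k.+1%:R^-1 - k.+2%:R^-1)%R.

Let gap_gt0 k : (0 < gap k)%R.
Proof. by rewrite subr_gt0 ltf_pV2 ?posrE// ltr_nat. Qed.

Let core_sep U k A B : A `<=` core U k -> B `<=` ~` core U k.+1 ->
  separated (gap k) A B.
Proof.
move=> AU BU a b /AU Ua /BU Ub; rewrite leNgt; apply/negP => ab; apply: Ub.
move=> x bx; apply: Ua; rewrite -(subrK (k.+2%:R^-1 : R)%R (k.+1%:R^-1)%R).
by apply: ball_triangle bx; rewrite -ball_normE.
Qed.

Let sum_sep U X p N :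
  \sum_(k < N.+1) hausdorff f (X `&` ring U (p + k.*2)) <=
  hausdorff f (X `&` core U (p + N.*2).+1).
Proof.
elim: N => [|N IH].
  by rewrite big_ord1; apply: le_hausdorff => x [Xx []].
rewrite big_ord_recr/= (le_trans (leeD2r _ IH))// doubleS !addnS.
set q := (p + N.*2).+1.
have sep : separated (gap q) (X `&` core U q) (X `&` ring U q.+1).
  by apply: (@core_sep U) => [x []|x [_ []]].
apply: le_trans (hausdorff_separated (gap_gt0 _) sep) _.
apply: le_hausdorff => x [[Xx Ux]|[Xx []//]]; split => //.
by apply: core_le Ux; rewrite leqW.
Qed.

Let sum_ring U X N :
  \sum_(k < N) hausdorff f (X `&` ring U k) <= hausdorff f X + hausdorff f X.
Proof.
pose h k := hausdorff f (X `&` ring U k).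
have h0 k : 0 <= h k by exact: hausdorff_ge0.
have half p : \sum_(k < N.+1) h (p + k.*2)%N <= hausdorff f X.
  by apply: le_trans (sum_sep U X p N) _; apply: le_hausdorff => x [].
apply: le_trans (leeD (half 0%N) (half 1%N)).
rewrite -big_split/=.
have -> : \sum_(k < N.+1) (h (0 + k.*2)%N + h (1 + k.*2)%N) =
    \sum_(k < N.+1.*2) h k.
  elim: N.+1 => [|M IH]; first by rewrite !big_ord0.
  by rewrite big_ord_recr doubleS/= !big_ord_recr/= IH add0n add1n addeA.
rewrite -!(big_mkord xpredT h); apply: lee_sum_nneg_natr => //.
by rewrite -addnn (leq_trans (leqnSn N))// leq_addr.
Qed.

Lemma open_caratheodory U : open U -> (hausdorff f).-caratheodory U.
Proof.
move=> oU; apply: le_caratheodory_measurable => X /=.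
have [XE|Xoo] := eqVneq (hausdorff f X) +oo; first by rewrite XE leey.
have Xfin : hausdorff f X \is a fin_num by rewrite ge0_fin_numE ?hausdorff_ge0// ltey.
pose h k := hausdorff f (X `&` ring U k).
have h0 k : 0 <= h k by exact: hausdorff_ge0.
have hoo : \sum_(0 <= k <oo) h k < +oo.
  apply: (@le_lt_trans _ _ (hausdorff f X + hausdorff f X)).
    apply: lime_le; first exact: is_cvg_nneseries.
    by apply: nearW => N; rewrite big_mkord; exact: sum_ring.
  by rewrite ltey_eq fin_numD Xfin.
have tail := nneseries_tail_cvg hoo (fun k _ => h0 k).
have step N : hausdorff f (X `&` U) + hausdorff f (X `&` ~` U) <=
    hausdorff f X + \sum_(N <= k <oo) h k.
  have XU : X `&` U `<=` (X `&` core U N) `|`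
      \bigcup_(k in ~` `I_N) (X `&` ring U k).
    move=> x [Xx Ux]; have [xN|xN] := pselect (core U N x); first by left.
    right.
    have [k xk] : exists k, core U k x.
      have /nbhs_ballP[e e0 xe] : nbhs x U by exact: open_nbhs_nbhs.
      have [k _ ke] := near_infty_natSinv_lt (PosNum e0).
      exists k; apply: subset_trans xe; apply: le_ball.
      exact/ltW/(ke k (leqnn k)).
    have : exists k, `[< core U k x >] by exists k; exact/asboolP.
    move=> /ex_minnP[[|m] /asboolP xm mmin].
      by exfalso; apply: xN; exact: core_le xm.
    exists m => /=.
      apply/negP; rewrite -leqNgt leqNgt; apply/negP => mN; apply: xN.
      exact: core_le xm.
    by split => //; split => // /asboolP/mmin; rewrite ltnn.
  have := le_trans (le_hausdorff XU) (outer_measureU2 (hausdorff f) _ _).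
  move=> /(leeD2r (hausdorff f (X `&` ~` U)))/le_trans; apply.
  rewrite addeAC; apply: leeD; last first.
    exact: (outer_measure_sigma_subadditive_tail (hausdorff f)).
  have sepN : separated N.+1%:R^-1%R (X `&` core U N) (X `&` ~` U).
    move=> a b [_ Ua] [_ Ub]; rewrite leNgt; apply/negP => ab; apply: Ub.
    by apply: Ua; rewrite -ball_normE.
  apply: le_trans (hausdorff_separated _ sepN) _; first by rewrite invr_gt0.
  by apply: le_hausdorff => x [[]|[]].
rewrite -[leRHS]adde0.
have : hausdorff f X + \sum_(N <= k <oo) h k @[N --> \oo] --> hausdorff f X + 0.
  by apply: cvgeD => //; [exact: fin_num_adde_defr|exact: cvg_cst].
move=> hc; rewrite -(cvg_lim _ hc)//; apply: lime_ge; first by apply: cvgP; exact: hc.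
exact: nearW.
Qed.

Definition hausdorff_measure : set (borelRn R n) -> \bar R := hausdorff f.

Let hausdorff_measure_sigma_additive : semi_sigma_additive hausdorff_measure.
Proof.
have sub : @measurable _ (borelRn R n) `<=` (hausdorff f).-cara.-measurable.
  apply: smallest_sub => [|U oU]; last exact: open_caratheodory.
  split => //; [by move=> X mX; rewrite setTD; exact: measurableC |
                by move=> u_ mu_; exact: bigcupT_measurable].
move=> F mF tF mUF; apply: caratheodory_measure_sigma_additive => //.
- by move=> i; exact: sub (mF i).
- exact: sub mUF.
Qed.

HB.instance Definition _ := isMeasure.Build _ _ _ hausdorff_measure
  hausdorff0 hausdorff_ge0 hausdorff_measure_sigma_additive.

End Hausdorff.
Arguments hausdorff_measure {R} n f.

Section ComplexL2.
Context d (T : measurableType d) (R : realType).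
Variable mu : {measure set T -> \bar R}.

Definition sqintegrable : {pred T -> R[i]} :=
  [pred g : T -> R[i] | (fun x => complex.Re (g x)) \in Lfun mu 2%:E
                      & (fun x => complex.Im (g x)) \in Lfun mu 2%:E].

Lemma sqintegrable_submod : submod_closed sqintegrable.
Proof.
have LfunD (u v : T -> R) : u \in Lfun mu 2%:E -> v \in Lfun mu 2%:E ->
    (fun x => u x + v x) \in Lfun mu 2%:E.
  have [_ +] := @Lfun_submod_closed _ T R mu 2%:E (lee1n 2).
  by move=> /(_ 1 u v) h uL vL; have := h uL vL; rewrite scale1r.
have LfunZ (a : R) (u : T -> R) : u \in Lfun mu 2%:E ->
    (fun x => a * u x) \in Lfun mu 2%:E.
  have [h0 +] := @Lfun_submod_closed _ T R mu 2%:E (lee1n 2).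
  by move=> /(_ a u 0) h uL; have := h uL h0; rewrite addr0.
split.
  by have [h0 _] := @Lfun_submod_closed _ T R mu 2%:E (lee1n 2); apply/andP.
move=> [a b] u v /andP[/= ur ui] /andP[/= vr vi]; apply/andP; split => /=.
- rewrite [X in X \in _](_ : _ = fun x => (a * complex.Re (u x) +
      (- b) * complex.Im (u x)) + complex.Re (v x)).
    by rewrite LfunD// LfunD// LfunZ.
  apply/funext => x; rewrite !fctE /=.
  by case: (u x) (v x) => [p q] [p' q'] /=; rewrite mulNr.
- rewrite [X in X \in _](_ : _ = fun x => (a * complex.Im (u x) +
      b * complex.Re (u x)) + complex.Im (v x)).
    by rewrite LfunD// LfunD// LfunZ.
  apply/funext => x; rewrite !fctE /=.
  by case: (u x) (v x) => [p q] [p' q'] /=.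
Qed.

HB.instance Definition _ :=
  GRing.isSubmodClosed.Build _ _ sqintegrable sqintegrable_submod.

Record L2fun := L2Fun { L2fun_val :> T -> R[i]; _ : L2fun_val \in sqintegrable }.
HB.instance Definition _ := [isSub for L2fun_val].
HB.instance Definition _ := [Choice of L2fun by <:].
HB.instance Definition _ := [SubChoice_isSubLmodule of L2fun by <:].

Definition L2null : {pred L2fun} :=
  [pred g : L2fun | `[< {ae mu, forall x, g x = 0} >]].

Lemma L2null_submod : submod_closed L2null.
Proof.
split; first by apply/asboolP; apply: aeW.
move=> a u v /asboolP u0 /asboolP v0; apply/asboolP.
apply: filterS2 u0 v0 => x /= ux vx.
by rewrite !fctE/= ux vx scaler0 addr0.
Qed.

HB.instance Definition _ := GRing.isSubmodClosed.Build _ _ L2null L2null_submod.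

(* [L2] of complex functions modulo equality [mu]-almost everywhere *)
Definition L2 := Quotient.quot (L2null : zmodClosed _).
HB.instance Definition _ := GRing.Zmodule.on L2.

Definition L2class (g : L2fun) : L2 := \pi_L2 g.

Lemma L2classP g h : L2class g = L2class h <-> {ae mu, forall x, g x = h x}.
Proof.
have -> : (L2class g = L2class h) <-> (g - h \in L2null).
  rewrite (@Quotient.idealrBE _ (L2null : zmodClosed _)).
  by split=> gh; apply/eqP.
split=> [/asboolP|] gh; [|apply/asboolP]; apply: filterS gh => x /=.
  by move/eqP; rewrite !fctE subr_eq0 => /eqP.
by move=> gh; rewrite !fctE gh subrr.
Qed.

Lemma L2classB : {morph L2class : g h / g - h}.
Proof. by move=> g h; rewrite /L2class !piE. Qed.

Lemma L2classD : {morph L2class : g h / g + h}.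
Proof. by move=> g h; rewrite /L2class !piE. Qed.

Lemma L2class_repr u : L2class (repr u) = u.
Proof. exact: reprK. Qed.

Definition L2scale (a : R[i]) (u : L2) : L2 := L2class (a *: repr u).

Lemma L2scaleE a g : L2scale a (L2class g) = L2class (a *: g).
Proof.
apply/L2classP; have /L2classP := L2class_repr (L2class g).
by apply: filterS => x /= gx; rewrite !fctE gx.
Qed.

Lemma L2scaleA a b u : L2scale a (L2scale b u) = L2scale (a * b) u.
Proof. by rewrite -(L2class_repr u) !L2scaleE scalerA. Qed.

Lemma L2scale1 : left_id 1 L2scale.
Proof. by move=> u; rewrite -(L2class_repr u) !L2scaleE scale1r. Qed.

Lemma L2scaleDr : right_distributive L2scale +%R.
Proof.
move=> a u v; rewrite -(L2class_repr u) -(L2class_repr v).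
by rewrite -L2classD !L2scaleE -L2classD scalerDr.
Qed.

Lemma L2scaleDl u : {morph L2scale^~ u : a b / a + b}.
Proof.
move=> a b; rewrite -(L2class_repr u).
by rewrite !L2scaleE -L2classD scalerDl.
Qed.

HB.instance Definition _ :=
  GRing.Zmodule_isLmodule.Build R[i] L2 L2scaleA L2scale1 L2scaleDr L2scaleDl.

Lemma L2classZ a g : L2class (a *: g) = a *: L2class g.
Proof. by rewrite -L2scaleE. Qed.

Definition cintegral (h : T -> R[i]) : R[i] :=
  Complex (Rintegral mu setT (fun x => complex.Re (h x)))
          (Rintegral mu setT (fun x => complex.Im (h x))).

Definition cintegrable (h : T -> R[i]) :=
  mu.-integrable setT (EFin \o (fun x => complex.Re (h x))) /\
  mu.-integrable setT (EFin \o (fun x => complex.Im (h x))).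

Lemma cintegralD (h k : T -> R[i]) : cintegrable h -> cintegrable k ->
  cintegral (fun x => h x + k x) = cintegral h + cintegral k.
Proof.
move=> [hr hi] [kr ki]; rewrite /cintegral.
have E (p q p' q' : R) : Complex p q + Complex p' q' = Complex (p + p') (q + q') by [].
rewrite E -!RintegralD//; congr Complex; apply: eq_Rintegral => x _;
  by case: (h x) (k x) => [? ?] [? ?].
Qed.

Lemma cintegralZ a (h : T -> R[i]) : cintegrable h ->
  cintegral (fun x => a * h x) = a * cintegral h.
Proof.
case: a => a b [hr hi]; rewrite /cintegral.
have E (p q p' q' : R) : Complex p q * Complex p' q' =
  Complex (p * p' + (- q) * q') (p * q' + q * p') by rewrite mulNr.
rewrite E -!RintegralZl// -!RintegralD//; last 4 first.
- exact: (integrableZl measurableT a hi).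
- exact: (integrableZl measurableT b hr).
- exact: (integrableZl measurableT a hr).
- exact: (integrableZl measurableT (- b) hi).
congr Complex; apply: eq_Rintegral => x _;
  by case: (h x) => [? ?] /=; rewrite ?mulNr.
Qed.

Lemma cintegral_conj (h : T -> R[i]) : cintegrable h ->
  cintegral (fun x => conjc (h x)) = conjc (cintegral h).
Proof.
move=> [hr hi]; rewrite /cintegral /=; congr Complex.
  by apply: eq_Rintegral => x _; case: (h x).
rewrite -mulN1r -RintegralZl//; apply: eq_Rintegral => x _.
by case: (h x) => [? ?] /=; rewrite mulN1r.
Qed.

Lemma ae_eq_cintegral (h k : T -> R[i]) : cintegrable h -> cintegrable k ->
  {ae mu, forall x, h x = k x} -> cintegral h = cintegral k.
Proof.
move=> [/measurable_int hr /measurable_int hi].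
move=> [/measurable_int kr /measurable_int ki] hk.
rewrite /cintegral /Rintegral; congr Complex; congr fine;
  by apply: ae_eq_integral => //; apply: filterS hk => x /= -> _.
Qed.

Lemma sqintegrable_mulJ (g h : L2fun) : cintegrable (fun x => g x * conjc (h x)).
Proof.
have ig (u v : T -> R) : u \in Lfun mu 2%:E -> v \in Lfun mu 2%:E ->
    mu.-integrable setT (EFin \o (fun x => u x * v x)).
  by move=> uL vL; apply/Lfun1_integrable; exact: Lfun2_mul_Lfun1.
case: g h => [g /andP[/= gr gi]] [h /andP[/= hr hi]]; split.
- have := integrableD measurableT (ig _ _ gr hr) (ig _ _ gi hi).
  apply: eq_integrable => // x _ /=.
  by case: (g x) (h x) => [? ?] [? ?] /=; rewrite mulrN opprK EFinD.
- have := integrableB measurableT (ig _ _ gi hr) (ig _ _ gr hi).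
  apply: eq_integrable => // x _ /=.
  by case: (g x) (h x) => [? ?] [? ?] /=; rewrite mulrN EFinD [RHS]addeC EFinN.
Qed.

Definition L2dot (u v : L2) : R[i] :=
  cintegral (fun x => repr u x * conjc (repr v x)).

Lemma L2dotE g h :
  L2dot (L2class g) (L2class h) = cintegral (fun x => g x * conjc (h x)).
Proof.
apply: ae_eq_cintegral; [exact: sqintegrable_mulJ..|].
have /L2classP gg := L2class_repr (L2class g).
have /L2classP hh := L2class_repr (L2class h).
by apply: filterS2 gg hh => x /= -> ->.
Qed.

Let L2dot_herm u v : L2dot u v = conjc (L2dot v u).
Proof.
rewrite -(L2class_repr u) -(L2class_repr v) !L2dotE.
rewrite -cintegral_conj; last exact: sqintegrable_mulJ.
by congr cintegral; apply/funext => x; rewrite rmorphM/= conjcK mulrC.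
Qed.

Let L2dotBl u v w : L2dot (u - v) w = L2dot u w - L2dot v w.
Proof.
rewrite -(L2class_repr u) -(L2class_repr v) -(L2class_repr w).
move: (repr u) (repr v) (repr w) => {}u {}v {}w.
have -> : L2class u - L2class v = L2class (u + (-1) *: v).
  by rewrite L2classD L2classZ scaleN1r.
rewrite !L2dotE -[- cintegral _]mulN1r.
rewrite -cintegralZ; last exact: sqintegrable_mulJ.
rewrite -cintegralD; last 2 first.
- exact: sqintegrable_mulJ.
- have := sqintegrable_mulJ ((-1) *: v) w.
  by congr cintegrable; apply/funext => x; exact/esym/mulrA.
by congr cintegral; apply/funext => x; rewrite mulrA -mulrDl.
Qed.

Let L2dotZl a u w : L2dot (a *: u) w = a * L2dot u w.
Proof.
rewrite -(L2class_repr u) -(L2class_repr w).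
rewrite -L2classZ !L2dotE -cintegralZ; last exact: sqintegrable_mulJ.
by congr cintegral; apply/funext => x; rewrite mulrA.
Qed.

Let L2dotBr w u v : L2dot w (u - v) = L2dot w u - L2dot w v.
Proof. by rewrite (L2dot_herm w u) (L2dot_herm w v) L2dot_herm L2dotBl rmorphB. Qed.

Let L2dotZr a w u : L2dot w (a *: u) = conjc a * L2dot w u.
Proof. by rewrite (L2dot_herm w u) L2dot_herm L2dotZl rmorphM. Qed.

Let L2dot_gt0 u : u != 0 -> 0 < L2dot u u.
Proof.
rewrite -(L2class_repr u); move: (repr u) => {}u u0.
rewrite L2dotE /cintegral ltcE/=; apply/andP; split.
  rewrite (_ : (fun x => _) = cst 0) ?Rintegral_cst// ?mul0r//.
  by apply/funext => x; case: (u x) => a b /=; rewrite mulrN mulrC addNr.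
have [ui _] := sqintegrable_mulJ u u.
rewrite lt_neqAle Rintegral_ge0 ?andbT; last first.
  by move=> x _; case: (u x) => a b /=; rewrite mulrN opprK addr_ge0// sqr_ge0.
apply: contra u0 => /eqP/esym uu.
have sq_ge0 x : 0 <= complex.Re (u x * conjc (u x)).
  by case: (u x) => a b /=; rewrite mulrN opprK addr_ge0// sqr_ge0.
have : (\int[mu]_x `|(complex.Re (u x * conjc (u x)))%:E| = 0)%E.
  rewrite -[RHS]/(EFin 0) -[X in EFin X]uu [RHS]fineK.
    by apply: eq_integral => x _; rewrite gee0_abs ?lee_fin.
  exact: (integrable_fin_num measurableT ui).
move=> /(ae_eq_integral_abs _ measurableT (measurable_int _ ui)) u_ae.
apply/eqP; rewrite -[RHS]L2class_repr; apply/L2classP.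
have /L2classP r0 : L2class (repr (0 : L2)) = L2class 0.
  by rewrite L2class_repr /L2class piE.
apply: filterS2 r0 u_ae => x /= -> /(_ Logic.I) [].
case: (u x) => a b /=; rewrite mulrN opprK -!expr2 => /eqP.
by rewrite paddr_eq0 ?sqr_ge0// !sqrf_eq0 => /andP[/eqP-> /eqP->].
Qed.

HB.instance Definition _ := @isBilinear.Build R[i] L2 L2 R[i] *%R
  (@conjc R \; *%R) L2dot (fun w u v => L2dotBl u v w)
  (fun w u v => L2dotBr w u v) (fun w a u => L2dotZl a u w)
  (fun w a u => L2dotZr a w u).

HB.instance Definition _ := @isHermitianSesquilinear.Build R[i] L2 false
  (@conjc R) L2dot (fun u v => etrans (L2dot_herm u v) (esym (mul1r _))).

HB.instance Definition _ := @isDotProduct.Build R[i] L2 L2dot L2dot_gt0.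

(* Multiplication by [phi]; the default [0] is not reached when [phi] is bounded
   and measurable, see [mulopE]. *)
Definition mulop (phi : T -> R) (u : L2) : L2 :=
  L2class (insubd 0 (fun x => (phi x)%:C%C * repr u x)).

Lemma Lfun2_mul_bounded (phi u : T -> R) M : measurable_fun setT phi ->
  {ae mu, forall x, `|phi x| <= M} ->
  u \in Lfun mu 2%:E -> (fun x => phi x * u x) \in Lfun mu 2%:E.
Proof.
move=> mphi phiM uL; have uL2 := Lfun2_integrable_sqr uL.
move: uL; rewrite inE => /andP[/[!inE]/= mu_ _].
have mpu : measurable_fun setT (fun x => phi x * u x) by exact: measurable_funM.
apply/andP; split; rewrite inE//= /finite_norm unlock poweR_lty//.
rewrite (eq_integral (fun x => ((phi x * u x) ^+ 2)%:E)); last first.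
  by move=> x _ /=; rewrite powR_mulrn// -normrX ger0_norm ?sqr_ge0.
apply: (@le_lt_trans _ _ (\int[mu]_x ((M ^+ 2)%:E * (u x ^+ 2)%:E))%E); last first.
  exact: integrable_lty (integrableZl measurableT (M ^+ 2) uL2).
apply: ae_ge0_le_integral => //.
- by move=> x _; rewrite lee_fin sqr_ge0.
- by apply/measurable_EFinP; exact: measurable_funX.
- by move=> x _; rewrite lee_fin mulr_ge0// sqr_ge0.
- apply/measurable_EFinP; apply: measurable_funM => //.
  exact: measurable_funX.
- apply: filterS phiM => x /= xM _; rewrite lee_fin exprMn.
  by rewrite ler_wpM2r ?sqr_ge0// -real_normK ?num_real// lerXn2r ?nnegrE// (le_trans _ xM).
Qed.

Lemma sqintegrable_mul (phi : T -> R) M (g : L2fun) : measurable_fun setT phi ->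
  {ae mu, forall x, `|phi x| <= M} ->
  (fun x => (phi x)%:C%C * g x) \in sqintegrable.
Proof.
move=> mphi phiM; case: g => g /andP[/= gr gi]; apply/andP; split => /=.
- rewrite [X in X \in _](_ : _ = fun x => phi x * complex.Re (g x)).
    exact: (Lfun2_mul_bounded mphi phiM gr).
  by apply/funext => x; case: (g x) => a b /=; rewrite mul0r subr0.
- rewrite [X in X \in _](_ : _ = fun x => phi x * complex.Im (g x)).
    exact: (Lfun2_mul_bounded mphi phiM gi).
  by apply/funext => x; case: (g x) => a b /=; rewrite mul0r addr0.
Qed.

Lemma mulopE (phi : T -> R) M (g h : L2fun) : measurable_fun setT phi ->
  {ae mu, forall x, `|phi x| <= M} ->
  (forall x, h x = (phi x)%:C%C * g x) -> mulop phi (L2class g) = L2class h.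
Proof.
move=> mphi phiM hE; apply/L2classP.
have /L2classP := L2class_repr (L2class g); apply: filterS => x /= gx.
by rewrite -[L2fun_val _ x]/(val _ x) insubdK ?(sqintegrable_mul _ mphi phiM)// gx hE.
Qed.

End ComplexL2.
Arguments L2dot {d T R} mu u v.
Arguments mulop {d T R} mu phi u.

Section GaugeProperties.
Variable R : realType.
Implicit Types (f : R -> R) (s : R).

(* [f] is [C^2] on the open half-line and [f'(0)] is the right derivative: a
   finite [f''(0)] would force [s >= 2] in [property_Rs]. *)
Definition property_R f :=
  [/\ convex_function (E := R^o) [set` `[0, +oo[] f,
      forall x, 0 < x -> [/\ derivable f x 1, derivable (f^`())%classic x 1
                           & {for x, continuous (f^`(2))%classic}]
    & (f x - f 0) / x @[x --> 0^'+] --> (0 : R)].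

Definition property_Rs s f :=
  property_R f /\
  forall a, 0 < a -> f (a * x) / f x @[x --> 0^'+] --> a `^ s.

Definition log_concave f :=
  convex_function (E := R^o) [set` `]0, +oo[] (fun x => - ln (f x)).

Definition gauge_inv f : R -> R := 'pinv_(fun=> 0) [set` `[0, +oo[] f.

Definition hgauge f (x : R) : R := (gauge_inv f x^-1)^-1.

End GaugeProperties.

Section QuasicentralModulus.
Variables (R : realType) (V : lmodType R[i]) (dot : {dot V for @conjc R}).
Implicit Types (A B P : {linear V -> V}) (F T : V -> V) (pi : nat -> R).

Definition finite_rank T := exists (k : nat) (b : 'I_k -> V),
  forall x, exists c : 'I_k -> R[i], T x = \sum_(i < k) c i *: b i.

Definition is_adjoint F G := forall x y, dot (F x) y = dot x (G y).

Definition op_le F T := forall x, dot (F x) x <= dot (T x) x.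

Definition finrank_proj : set {linear V -> V} :=
  [set P | [/\ finite_rank P, is_adjoint P P & forall x, P (P x) = P x]].

(* The order of [R[i]] compares complex numbers with the same imaginary part, so
   the second condition says that every [dot (A x) x] is real and nonnegative. *)
Definition R1plus : set {linear V -> V} :=
  [set A | [/\ finite_rank A, forall x, 0 <= dot (A x) x
             & forall x, dot (A x) (A x) <= dot x x]].

(* [s] lists, with multiplicity, the square roots of the eigenvalues of [F^* F]
   on a finite-dimensional subspace on whose orthogonal complement [F] vanishes,
   i.e. the singular values of [F] up to order and trailing zeros. *)
Definition singular_values F (s : seq R) :=
  (forall i : 'I_(size s), 0 <= s`_i) /\
  exists (G : V -> V) (e : 'I_(size s) -> V),
    [/\ is_adjoint F G,
        forall i j, dot (e i) (e j) = (i == j)%:R,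
        forall i, G (F (e i)) = (s`_i ^+ 2)%:C%C *: e i
      & forall x, (forall i, dot x (e i) = 0) -> F x = 0].

(* The weights are indexed from [0]: [pi j] is the weight of the [j.+1]-th largest
   modulus. *)
Definition Phi pi (xi : seq R) : R :=
  \sum_(j < size xi) pi j * (sort (fun x y => y <= x) [seq `|x| | x <- xi])`_j.

Definition finrank_norm pi F : R :=
  xget 0 [set Phi pi s | s in singular_values F].

Definition op_norm pi T : \bar R :=
  ereal_sup [set (finrank_norm pi (P \o T))%:E | P in finrank_proj].

Definition tuple_norm pi n (tau : 'I_n -> V -> V) : \bar R :=
  (\big[maxe/0]_(i < n) op_norm pi (tau i))%E.

Definition commutator F T : V -> V := fun x => F (T x) - T (F x).

Definition qc_modulus pi n (tau : 'I_n -> V -> V) : \bar R :=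
  ereal_sup [set ereal_inf [set tuple_norm pi (fun i => commutator A (tau i))
                           | A in [set A | R1plus A /\ op_le B A]]
            | B in R1plus].

End QuasicentralModulus.

Section Ampliation.
Variables (R : realType) (V : lmodType R[i]) (dot : {dot V for @conjc R}).
Variable m : nat.
Local Notation W := {ffun 'I_m -> V}.

Definition ampl (T : V -> V) (u : W) : W := [ffun i => T (u i)].

Definition ampl_dot (u v : W) : R[i] := \sum_(i < m) dot (u i) (v i).

Let ampl_dotBl w : zmod_morphism (ampl_dot ^~ w).
Proof.
move=> u v; rewrite /ampl_dot -sumrB; apply: eq_bigr => i _.
by rewrite !ffunE; exact: linearBl.
Qed.

Let ampl_dotBr w : zmod_morphism (ampl_dot w).
Proof.
move=> u v; rewrite /ampl_dot -sumrB; apply: eq_bigr => i _.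
by rewrite !ffunE; exact: linearBr.
Qed.

Let ampl_dotZl w : scalable_for *%R (ampl_dot ^~ w).
Proof.
move=> a u; rewrite /ampl_dot mulr_sumr; apply: eq_bigr => i _.
by rewrite !ffunE; exact: linearZl_LR.
Qed.

Let ampl_dotZr w : scalable_for (@conjc R \; *%R) (ampl_dot w).
Proof.
move=> a u; rewrite /ampl_dot /= mulr_sumr; apply: eq_bigr => i _.
by rewrite !ffunE; apply: linearr_subproof.
Qed.

Let ampl_dot_herm u v :
  ampl_dot u v = (-1) ^+ false * conjc (ampl_dot v u).
Proof.
rewrite mul1r rmorph_sum; apply: eq_bigr => i _.
by rewrite -[RHS]mul1r; apply: hermitian_subproof.
Qed.

Let ampl_dot_gt0 u : u != 0 -> 0 < ampl_dot u u.
Proof.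
move=> /eqP u0.
have dot_ge0 v : 0 <= dot v v.
  have [->|v0] := eqVneq v 0; last exact/ltW/neq0_dnorm_gt0.
  by rewrite -{2}(subrr (0 : V)) linearBr subrr.
have [i ui] : exists i, u i != 0.
  apply: contrapT => /forallNP h; apply: u0; apply/ffunP => i.
  by rewrite ffunE; apply/eqP/negPn/negP; exact: h.
rewrite /ampl_dot (bigD1 i)//= ltr_pwDl ?sumr_ge0//.
exact: neq0_dnorm_gt0.
Qed.

HB.instance Definition _ := @isBilinear.Build R[i] W W R[i] *%R
  (@conjc R \; *%R) ampl_dot ampl_dotBl ampl_dotBr ampl_dotZl ampl_dotZr.
HB.instance Definition _ :=
  @isHermitianSesquilinear.Build R[i] W false (@conjc R) ampl_dot ampl_dot_herm.
HB.instance Definition _ := @isDotProduct.Build R[i] W ampl_dot ampl_dot_gt0.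

End Ampliation.
Arguments ampl_dot {R V} dot m u v.
Arguments ampl {R V} m T u.

Section CoordinateMultiplication.
Variables (R : realType) (n : nat).
Variable mu : {measure set (borelRn R n) -> \bar R}.
Variables (Omega : set (borelRn R n)) (mOmega : measurable Omega).

(* [L2(Omega, mu)] is the [L2] space of the measure [A |-> mu (A `&` Omega)]. *)
Local Notation H := (L2 (mrestr mu mOmega)).

Definition coord (j : 'I_n) (x : borelRn R n) : R := (x : 'rV[R]_n) ord0 j.

Definition tau_mult (j : 'I_n) : H -> H := mulop (mrestr mu mOmega) (coord j).

Lemma measurable_coord j : measurable_fun setT (coord j).
Proof.
apply: (measurability _ (RGenOpens.measurableE R)) => //.
move=> _ [_ [a [b ->]] <-]; rewrite setTI.
apply: sub_sigma_algebra.
apply: (@open_comp _ _ (coord j : 'rV[R]_n -> R)); last exact: interval_open.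
by move=> x _; exact: coord_continuous.
Qed.

Lemma tau_multE j (g h : L2fun (mrestr mu mOmega)) :
  bounded_set (Omega : set 'rV[R]_n) ->
  (forall x, h x = (coord j x)%:C%C * g x) ->
  tau_mult j (L2class g) = L2class h.
Proof.
move=> [M [_ OM]] hE; apply: (@mulopE _ _ _ _ _ (M + 1)) => //.
  exact: measurable_coord.
exists (~` Omega); split; first exact: measurableC.
  by rewrite /= /mrestr setICl measure0.
move=> x /= xM Ox; apply: xM; have := OM (M + 1) (ltac:(by rewrite ltrDl)) x Ox.
apply: le_trans; rewrite [leRHS]mx_normrE.
exact: (le_bigmax _ (fun i => `|(x : 'rV[R]_n) i.1 i.2|) (ord0, j)).
Qed.

End CoordinateMultiplication.
Arguments tau_mult {R n} mu {Omega} mOmega j u.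

(* Main.v *)
From HB Require Import structures.
Require Import Defs.
From mathcomp Require Import all_boot all_order all_algebra.
From mathcomp Require Import sesquilinear spectral.
From mathcomp Require Import all_classical all_reals all_analysis.
From mathcomp Require Import complex ring lra.
Set Implicit Arguments.
Unset Strict Implicit.
Unset Printing Implicit Defensive.
Import Order.TTheory GRing.Theory Num.Theory.
Import numFieldNormedType.Exports.
Local Open Scope classical_set_scope.
Local Open Scope ring_scope.

Local Notation Re := complex.Re.
Local Notation Im := complex.Im.

(** The equality is an instance of a general homogeneity property, valid for every
    tuple [tau] of symmetric operators and every positive nonincreasing weight
    sequence [pi] with [m * pi (j * m + c) / pi j --> M] for [c = 0] and [c = m - 1]
    ([qc_modulus_ampl]).  It is combined with two facts: coordinate
    multiplications are symmetric ([tau_mult_adjoint]), and the weights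
    [h'(N + j)] satisfy the ratio condition with [M = m^(1/s)]
    ([hgauge_weights_cvg]).

    Operator part.  If [T] has singular values [t 0 >= t 1 >= ...], those of
    [T (x) I_m] are the same with each one repeated [m] times, so their weighted
    sum lies between [sum_j m pi (j m + m - 1) t j] and [sum_j m pi (j m) t j].
    Both differ from [M * sum_j pi j t j] by a small proportion of that sum,
    plus a constant times the largest singular value
    ([sum_eventually_le]).  Homogeneity therefore follows once the
    commutators can be taken of small operator norm.  This is [qc_bound_small]: if
    [A2] is chosen after [A1] and equals the identity on a large enough space, then
    [[A1, tau j]] and [[A2, tau j]] live on orthogonal subspaces, so averaging [A1]
    and [A2] halves the bound on the operator norm while convexity preserves the
    bound on the weighted norm; iterate.  For the inequality [<=] one ampliates
    [A]; for [>=] one replaces [A] on the [m]-fold sum by the normalized partial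
    trace [A'], for which the weighted sum of [[A', tau j]] is
    controlled by that of [[A, tau j (x) I]] ([partial_trace_dual_ge]).

    All estimates on the norm go through its dual description
    ([op_norm_le_dual]): [|T|_pi <= c] means [sum_j pi j Re <T e_j, f_j> <= c] for all
    finite families [e], [f] satisfying Bessel's inequality.  One half is Ky Fan's
    inequality for doubly substochastic matrices; the other half needs singular
    values to exist, and for an antihermitian operator of finite rank, which a
    commutator is, they come from diagonalizing a normal matrix.

    Analytic part.  With [t = f^-1 (1/x)] one has
    [h'(x) = 1 / (x t e(t))] where [e(t) = t f'(t) / f(t)].  Tangents of the convex [f]
    give [(a - 1) e(t) <= f (a t) / f t - 1] for all [a > 0]; as the right-hand side
    tends to [a^s - 1], letting [a --> 1] from both sides gives [e(t) --> s].  Since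
    [f] is regularly varying of index [s], [f^-1 (1/x)] scales like [x^(-1/s)], and
    the two facts together give the limit of [h'(x') / h'(x)] when [x' / x --> m]. *)

(** * Complex inner products and Bessel families *)

Section SquaredModulus.
Variable R : realType.
Implicit Types z w : R[i].

Definition sqc z : R := Re z ^+ 2 + Im z ^+ 2.

Lemma ReD z w : Re (z + w) = Re z + Re w.
Proof. by case: z w => [? ?] [? ?]. Qed.

Lemma ReN z : Re (- z) = - Re z.
Proof. by case: z. Qed.

Lemma ReM z w : Re (z * w) = Re z * Re w - Im z * Im w.
Proof. by case: z w => [? ?] [? ?]. Qed.

Lemma ReZ (a : R) z : Re (a%:C%C * z) = a * Re z.
Proof. by rewrite ReM /= mul0r subr0. Qed.

Lemma Re_conjc z : Re (conjc z) = Re z.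
Proof. by case: z. Qed.

Lemma Re_sum (I : Type) (r : seq I) (P : pred I) (F : I -> R[i]) :
  Re (\sum_(i <- r | P i) F i) = \sum_(i <- r | P i) Re (F i).
Proof. exact: (big_morph _ ReD). Qed.

Lemma mulcJE z : z * conjc z = (sqc z)%:C%C.
Proof. by case: z => a b; rewrite /sqc /=; congr Complex; ring. Qed.

Lemma sqc_ge0 z : 0 <= sqc z.
Proof. by rewrite addr_ge0 ?sqr_ge0. Qed.

Lemma sqc_conjc z : sqc (conjc z) = sqc z.
Proof. by case: z => a b; rewrite /sqc /= sqrrN. Qed.

Lemma Re_mul_le z w : Re (z * w) <= (sqc z + sqc w) / 2.
Proof.
case: z w => [a b] [c d]; rewrite /sqc /=.
have := sqr_ge0 (a - c); have := sqr_ge0 (b + d); nra.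
Qed.

End SquaredModulus.

Section InnerProduct.
Variables (R : realType) (V : lmodType R[i]) (dot : {dot V for @conjc R}).
Implicit Types (x y z : V) (a : R[i]).

Definition nsq x : R := Re (dot x x).

Lemma dotC x y : dot x y = conjc (dot y x).
Proof. by rewrite [LHS]hermC expr0 mul1r. Qed.

Lemma dotDl x y z : dot (x + y) z = dot x z + dot y z.
Proof. exact: linearDl. Qed.
Lemma dotDr x y z : dot z (x + y) = dot z x + dot z y.
Proof. exact: linearDr. Qed.
Lemma dotBl x y z : dot (x - y) z = dot x z - dot y z.
Proof. exact: linearBl. Qed.
Lemma dotBr x y z : dot z (x - y) = dot z x - dot z y.
Proof. exact: linearBr. Qed.
Lemma dotZl a x z : dot (a *: x) z = a * dot x z.
Proof. exact: linearZl_LR. Qed.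
Lemma dotZr a x z : dot z (a *: x) = conjc a * dot z x.
Proof. exact: linearZr_LR. Qed.
Lemma dot0l z : dot 0 z = 0. Proof. exact: linear0l. Qed.
Lemma dot0r z : dot z 0 = 0. Proof. exact: linear0r. Qed.

Lemma dot_suml (I : Type) (r : seq I) (P : pred I) (F : I -> V) z :
  dot (\sum_(i <- r | P i) F i) z = \sum_(i <- r | P i) dot (F i) z.
Proof. exact: linear_sumlz. Qed.

Lemma dot_sumr (I : Type) (r : seq I) (P : pred I) (F : I -> V) z :
  dot z (\sum_(i <- r | P i) F i) = \sum_(i <- r | P i) dot z (F i).
Proof. exact: linear_sumr. Qed.

Lemma dot_ge0 x : 0 <= dot x x.
Proof.
have [->|x0] := eqVneq x 0; first by rewrite dot0l.
exact/ltW/neq0_dnorm_gt0.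
Qed.

Lemma dotxx x : dot x x = (nsq x)%:C%C.
Proof.
have := dot_ge0 x; rewrite /nsq; case: (dot x x) => a b.
by rewrite lecE/= => /andP[/eqP-> _].
Qed.

Lemma nsq_ge0 x : 0 <= nsq x.
Proof. by rewrite -ler0c -dotxx dot_ge0. Qed.

Lemma nsq_eq0 x : (nsq x == 0) = (x == 0).
Proof.
apply/idP/idP => [|/eqP->]; last by rewrite /nsq dot0l.
apply: contraTT => x0; have := @neq0_dnorm_gt0 _ _ _ dot _ x0.
by rewrite dotxx ltcR lt0r => /andP[].
Qed.

Lemma nsqZ a x : nsq (a *: x) = sqc a * nsq x.
Proof. by rewrite /nsq dotZl dotZr mulrA mulcJE ReZ. Qed.

Lemma nsqD x y : nsq (x + y) = nsq x + nsq y + 2 * Re (dot x y).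
Proof. by rewrite /nsq dotDl !dotDr !ReD (dotC y x) Re_conjc; ring. Qed.

Lemma nsqB x y : nsq (x - y) = nsq x + nsq y - 2 * Re (dot x y).
Proof.
rewrite /nsq dotBl !dotBr !ReD !ReN ReD ReN (dotC y x) Re_conjc; ring.
Qed.

Lemma Re_dotC x y : Re (dot x y) = Re (dot y x).
Proof. by rewrite dotC Re_conjc. Qed.

Lemma dot_ext x y : (forall z, dot x z = dot y z) -> x = y.
Proof.
move=> h; apply/eqP; rewrite -subr_eq0 -nsq_eq0 /nsq.
by rewrite dotBl h subrr.
Qed.

(** Bessel's inequality replaces orthonormality throughout: unlike the latter it
    survives the replacement of some vectors by 0. *)
Definition bessel (I : finType) (e : I -> V) :=
  forall x, \sum_i sqc (dot x (e i)) <= nsq x.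

(** With [y] the sum of the [<x, e_i> e_i], expand [0 <= |x - y|^2]; norms below 1
    only help, so the vectors may also vanish. *)
Lemma bessel_orthogonal (I : finType) (e : I -> V) :
  (forall i j, i != j -> dot (e i) (e j) = 0) -> (forall i, nsq (e i) <= 1) ->
  bessel e.
Proof.
move=> eo e1 x.
pose y := \sum_i dot x (e i) *: e i.
have xy : Re (dot x y) = \sum_i sqc (dot x (e i)).
  rewrite dot_sumr Re_sum; apply: eq_bigr => i _.
  by rewrite dotZr mulrC mulcJE.
have yy : nsq y <= \sum_i sqc (dot x (e i)).
  rewrite /nsq {1}/y dot_suml Re_sum; apply: ler_sum => i _.
  rewrite dotZl dot_sumr (bigD1 i)//= big1 ?addr0; last first.
    by move=> j ji; rewrite dotZr eo 1?eq_sym ?mulr0.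
  by rewrite dotZr mulrA mulcJE ReZ ler_piMr ?sqc_ge0// e1.
have := nsq_ge0 (x - y); rewrite nsqB xy.
by move: yy; set S := \sum_i _; lra.
Qed.

Lemma bessel_nsq (I : finType) (e : I -> V) i : bessel e -> nsq (e i) <= 1.
Proof.
move=> /(_ (e i)); rewrite (bigD1 i)//= dotxx.
set S := \sum_(j | _) _; have S0 : 0 <= S by apply: sumr_ge0 => j _; exact: sqc_ge0.
rewrite /sqc /= => h.
have := nsq_ge0 (e i); nra.
Qed.

Lemma bessel_restrict (I : finType) (e : I -> V) (P : pred I) :
  bessel e -> bessel (fun i => if P i then e i else 0).
Proof.
move=> be x; apply: le_trans (be x); apply: ler_sum => i _.
by case: ifP => // _; rewrite dot0r /sqc expr0n addr0 sqc_ge0.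
Qed.

Lemma bessel1 x : nsq x <= 1 -> bessel (fun _ : 'I_1 => x).
Proof.
by move=> x1; apply: bessel_orthogonal => // i j; rewrite !ord1 eqxx.
Qed.

End InnerProduct.

(** * Ky Fan duality for weighted singular value norms *)

Section Weights.
Variable R : realType.
Implicit Types (pi s d : nat -> R).

(** Abel summation in a form suited to induction: the last weight [s q] is the
    smallest one. *)
Lemma sum_abel_ge d s q : (forall i, s i.+1 <= s i) ->
  (forall l, (l <= q)%N -> 0 <= \sum_(i < l) d i) ->
  s q * \sum_(i < q.+1) d i <= \sum_(i < q.+1) s i * d i.
Proof.
move=> ns; elim: q => [|q IH] dl; first by rewrite !big_ord1.
rewrite [leRHS]big_ord_recr [in leLHS]big_ord_recr /= mulrDr lerD2r.
apply: le_trans (IH _); last by move=> l lq; apply: dl; rewrite leqW.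
by apply: ler_wpM2r; rewrite ?dl.
Qed.

Lemma sum_abel d s q : (forall i, s i.+1 <= s i) -> (forall i, 0 <= s i) ->
  (forall l, (l <= q)%N -> 0 <= \sum_(i < l) d i) ->
  0 <= \sum_(i < q) s i * d i.
Proof.
move=> ns s0; case: q => [|q] dl; first by rewrite big_ord0.
apply: le_trans (sum_abel_ge ns _); last by move=> l lq; apply: dl; rewrite leqW.
by rewrite mulr_ge0 ?dl.
Qed.

(** A fractional choice of total mass [l] among nonincreasing weights is worth at most
    the first [l] weights: subtract [pi l] from all of them. *)
Lemma sum_weights_le pi p l (a : 'I_p -> R) : (forall i, pi i.+1 <= pi i) ->
  (forall i, 0 <= pi i) -> (forall j, 0 <= a j <= 1) -> \sum_j a j <= l%:R ->
  \sum_(j < p) pi j * a j <= \sum_(j < l) pi j.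
Proof.
move=> npi pi0 a01 al.
have mpi i j : (i <= j)%N -> pi j <= pi i.
  exact: (nonincreasing_seqP _).1 npi i j.
have -> : \sum_(j < l) pi j = \sum_(j < l) (pi j - pi l) + pi l * l%:R.
  by rewrite sumrB sumr_const card_ord mulr_natr subrK.
have -> : \sum_(j < p) pi j * a j =
    \sum_(j < p) (pi j - pi l) * a j + pi l * \sum_j a j.
  by rewrite mulr_sumr -big_split; apply: eq_bigr => j _ /=; rewrite mulrBl subrK.
apply: lerD; last exact: ler_wpM2l.
apply: (@le_trans _ _ (\sum_(j < p | (j < l)%N) (pi j - pi l))).
  rewrite [leRHS]big_mkcond /=; apply: ler_sum => j _.
  have /andP[aj0 aj1] := a01 j.
  case: ltnP => jl; first by rewrite ler_piMr ?subr_ge0 ?mpi// ltnW.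
  by rewrite mulr_le0_ge0// subr_le0 mpi.
have [pl|lp] := leqP p l.
  rewrite (eq_bigl xpredT); last by move=> j; rewrite (leq_trans (ltn_ord j) pl).
  rewrite (big_ord_widen l (fun j => pi j - pi l) pl) big_mkcond /=.
  by apply: ler_sum => j _; case: ifP => // _; rewrite subr_ge0 mpi// ltnW.
by rewrite (big_ord_widen p (fun j => pi j - pi l) (ltnW lp)).
Qed.

(** Rearrangement inequality for doubly substochastic matrices, by Abel summation in
    [s] of the partial sums controlled by [sum_weights_le]. *)
Lemma sum_substochastic_le pi s p q (D : 'I_p -> 'I_q -> R) :
  (forall i, pi i.+1 <= pi i) -> (forall i, 0 <= pi i) ->
  (forall i, s i.+1 <= s i) -> (forall i, 0 <= s i) ->
  (forall j i, 0 <= D j i) -> (forall j, \sum_i D j i <= 1) ->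
  (forall i, \sum_j D j i <= 1) ->
  \sum_(j < p) pi j * \sum_(i < q) s i * D j i <= \sum_(i < q) pi i * s i.
Proof.
move=> npi pi0 ns s0 D0 Dr Dc.
pose b i := oapp (fun i : 'I_q => \sum_(j < p) pi j * D j i) 0 (insub i).
have bE (i : 'I_q) : b i = \sum_(j < p) pi j * D j i by rewrite /b valK.
rewrite -subr_ge0.
have -> : \sum_(i < q) pi i * s i - \sum_(j < p) pi j * \sum_(i < q) s i * D j i =
    \sum_(i < q) s i * (pi i - b i).
  rewrite (eq_bigr (fun j : 'I_p => \sum_(i < q) pi j * (s i * D j i))); last first.
    by move=> j _; rewrite mulr_sumr.
  rewrite exchange_big -sumrB; apply: eq_bigr => i _ /=.
  rewrite mulrBr bE mulr_sumr mulrC; congr (_ - _).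
  by apply: eq_bigr => j _; rewrite mulrCA.
apply: (@sum_abel (fun i => pi i - b i)) => // l lq; rewrite sumrB subr_ge0.
rewrite (big_ord_widen q b lq) (eq_bigr (fun i : 'I_q => \sum_(j < p) pi j * D j i)); last first.
  by move=> i _; rewrite bE.
rewrite exchange_big /= (eq_bigr (fun j : 'I_p => pi j * \sum_(i < q | (i < l)%N) D j i)); last first.
  by move=> j _; rewrite mulr_sumr.
apply: sum_weights_le => // [j|].
  rewrite sumr_ge0//= (le_trans _ (Dr j))// big_mkcond ler_sum// => i _.
  by case: ifP.
rewrite exchange_big /= -[l in leRHS](card_ord l) -sum1_card natr_sum.
rewrite (big_ord_widen q (fun=> 1%:R) lq); exact: ler_sum.
Qed.

End Weights.

Section DualNorm.
Variables (R : realType) (V : lmodType R[i]) (dot : {dot V for @conjc R}).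
Implicit Types (x y z : V) (T : V -> V) (pi s : nat -> R).

(** The dual description of [|T|_pi <= c].  Real parts suffice, because a phase can be
    absorbed into [f]. *)
Definition dual_le pi T (c : R) := forall k (e f : 'I_k -> V),
  bessel dot e -> bessel dot f -> \sum_(j < k) pi j * Re (dot (T (e j)) (f j)) <= c.

(** A singular value decomposition, where [e] and [f] are only required to be Bessel
    so that [f i] may be 0 when [t i] is. *)
Definition schmidt_form T k s (e f : 'I_k -> V) :=
  [/\ bessel dot e, bessel dot f &
     forall x, T x = \sum_(i < k) ((s i)%:C%C * dot x (e i)) *: f i].

(** Ky Fan's inequality: by [2 Re (z w) <= |z|^2 + |w|^2] the sum is dominated by a
    doubly substochastic combination of the products [pi j * s i]. *)
Lemma schmidt_dual_le pi T k s (e f : 'I_k -> V) :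
  (forall i, pi i.+1 <= pi i) -> (forall i, 0 <= pi i) ->
  (forall i, s i.+1 <= s i) -> (forall i, 0 <= s i) ->
  schmidt_form T s e f -> dual_le pi T (\sum_(i < k) pi i * s i).
Proof.
move=> npi pi0 ns s0 [be bf TE] p e' f' be' bf'.
pose D (j : 'I_p) (i : 'I_k) : R := (sqc (dot (e' j) (e i)) + sqc (dot (f i) (f' j))) / 2.
apply: le_trans (_ : _ <= \sum_(j < p) pi j * \sum_(i < k) s i * D j i) _.
  apply: ler_sum => j _; apply: ler_wpM2l => //.
  rewrite TE dot_suml Re_sum; apply: ler_sum => i _.
  rewrite dotZl -mulrA ReZ; apply: ler_wpM2l => //; exact: Re_mul_le.
apply: sum_substochastic_le => // [j i|j|i].
- by rewrite divr_ge0// addr_ge0 ?sqc_ge0.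
- rewrite -mulr_suml big_split /=.
  have h1 := le_trans (be (e' j)) (bessel_nsq j be').
  have h2 := le_trans (bf (f' j)) (bessel_nsq j bf').
  rewrite [X in _ + X](eq_bigr (fun i => sqc (dot (f' j) (f i)))); last first.
    by move=> i _; rewrite dotC sqc_conjc.
  lra.
- rewrite -mulr_suml big_split /=.
  have h1 := le_trans (be' (e i)) (bessel_nsq i be).
  have h2 := le_trans (bf' (f i)) (bessel_nsq i bf).
  rewrite [X in X + _](eq_bigr (fun j => sqc (dot (e i) (e' j)))); last first.
    by move=> j _; rewrite dotC sqc_conjc.
  lra.
Qed.

End DualNorm.

(** * Spectral decomposition of antihermitian operators of finite rank *)

Section Spectral.
Variables (R : realType) (V : lmodType R[i]) (dot : {dot V for @conjc R}).
Implicit Types (x y z : V) (T : V -> V) (pi s : nat -> R).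

(** Commutators of symmetric operators have this property, which provides an adjoint
    and makes the compression to a finite-dimensional space a normal matrix. *)
Definition antiherm T := forall x y, dot (T x) y = - dot x (T y).

(** Linearity is automatic for an operator that has an adjoint. *)
Lemma adjoint_linear F G : is_adjoint dot F G ->
  forall a x y, F (a *: x + y) = a *: F x + F y.
Proof.
move=> FG a x y; apply: (@dot_ext _ _ dot) => z.
by rewrite FG !dotDl !dotZl !FG.
Qed.

Lemma adjoint0 F G : is_adjoint dot F G -> F 0 = 0.
Proof. by move=> FG; apply: (@dot_ext _ _ dot) => z; rewrite FG !dot0l. Qed.

Lemma adjointZ F G a x : is_adjoint dot F G -> F (a *: x) = a *: F x.
Proof.
by move=> FG; rewrite -[a *: x]addr0 (adjoint_linear FG) (adjoint0 FG) addr0.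
Qed.

Lemma adjointD F G x y : is_adjoint dot F G -> F (x + y) = F x + F y.
Proof. by move=> FG; rewrite -[x]scale1r (adjoint_linear FG) !scale1r. Qed.

Lemma antiherm_adjoint T : antiherm T -> is_adjoint dot T (fun x => - T x).
Proof. by move=> kT x y; rewrite kT linearNr. Qed.

Lemma adjoint_sum F G (I : Type) (r : seq I) (P : pred I) (c : I -> R[i]) (v : I -> V) :
  is_adjoint dot F G ->
  F (\sum_(i <- r | P i) c i *: v i) = \sum_(i <- r | P i) c i *: F (v i).
Proof.
move=> FG; apply: (@dot_ext _ _ dot) => z.
by rewrite FG !dot_suml; apply: eq_bigr => i _; rewrite !dotZl FG.
Qed.

Definition orthonormal_family (I : finType) (e : I -> V) :=
  forall i j, dot (e i) (e j) = (i == j)%:R.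

Lemma orthonormal_bessel (I : finType) (e : I -> V) :
  orthonormal_family e -> bessel dot e.
Proof.
move=> oe; apply: bessel_orthogonal => [i j /negbTE ij|i].
  by rewrite oe ij.
by rewrite /nsq oe eqxx.
Qed.

Definition proj_family k (u : 'I_k -> V) x := \sum_i dot x (u i) *: u i.

Lemma dot_proj_family k (u : 'I_k -> V) x y :
  dot (proj_family u x) y = dot x (proj_family u y).
Proof.
rewrite dot_suml dot_sumr; apply: eq_bigr => i _.
by rewrite dotZl dotZr mulrC -dotC.
Qed.

Lemma proj_familyP k (u : 'I_k -> V) i x : orthonormal_family u ->
  dot (proj_family u x) (u i) = dot x (u i).
Proof.
move=> ou; rewrite dot_suml (bigD1 i)//= big1 ?addr0; last first.
  by move=> j /negbTE ji; rewrite dotZl ou ji mulr0.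
by rewrite dotZl ou eqxx mulr1.
Qed.

Lemma proj_family_idem k (u : 'I_k -> V) x : orthonormal_family u ->
  proj_family u (proj_family u x) = proj_family u x.
Proof. by move=> ou; apply: eq_bigr => i _; rewrite proj_familyP. Qed.

(** Gram-Schmidt, one vector at a time. *)
Lemma orthonormal_span (L : seq V) : exists k (u : 'I_k -> V),
  orthonormal_family u /\ forall v, v \in L -> proj_family u v = v.
Proof.
elim: L => [|v L [k [u [ou uL]]]].
  by exists 0%N, (fun=> 0); split => // -[].
pose w := v - proj_family u v.
have wu i : dot w (u i) = 0 by rewrite dotBl proj_familyP// subrr.
have uw i : dot (u i) w = 0 by rewrite dotC wu conjc0.
have [w0|w0] := eqVneq w 0.
  exists k, u; split => // v'; rewrite inE => /orP[/eqP ->|/uL//].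
  by apply/esym/eqP; rewrite -subr_eq0 -/w w0.
have nw : nsq dot w != 0 by rewrite nsq_eq0.
have nw0 : 0 < nsq dot w by rewrite lt0r nw nsq_ge0.
pose c : R := (Num.sqrt (nsq dot w))^-1.
have cw : c ^+ 2 * nsq dot w = 1.
  by rewrite exprVn sqr_sqrtr ?nsq_ge0// mulVf.
pose u' (i : 'I_k.+1) := oapp u (c%:C%C *: w) (unlift ord_max i).
have u'w : u' ord_max = c%:C%C *: w by rewrite /u' unlift_none.
have u'u i : u' (lift ord_max i) = u i by rewrite /u' liftK.
have projE x : proj_family u' x = proj_family u x + (c ^+ 2)%:C%C * dot x w *: w.
  rewrite /proj_family (bigD1 ord_max)//= addrC; congr (_ + _); last first.
    rewrite u'w dotZr scalerA conjc_real mulrC mulrA -rmorphM.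
    by rewrite -expr2.
  rewrite (reindex_omap (lift ord_max) (unlift ord_max))/=; last first.
    by move=> i; case: unliftP => [j ->|->]; rewrite ?eqxx.
  apply: eq_big => i; last by rewrite u'u.
  by rewrite liftK !eqxx andbT eq_sym neq_lift.
exists k.+1, u'; split => [i j|x].
  case: (unliftP ord_max i) => [i'|] ->; case: (unliftP ord_max j) => [j'|] ->.
  - by rewrite !u'u ou (inj_eq lift_inj).
  - by rewrite u'u u'w dotZr uw mulr0 eq_sym (negbTE (neq_lift _ _)).
  - by rewrite u'u u'w dotZl wu mulr0 (negbTE (neq_lift _ _)).
  - rewrite u'w dotZl dotZr dotxx eqxx conjc_real -!rmorphM mulrA -expr2.
    by rewrite cw.
have pw y : proj_family u y = y -> dot y w = 0.
  move=> <-; rewrite dot_suml big1// => i _.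
  by rewrite dotZl uw mulr0.
rewrite inE => /orP[/eqP ->|xL].
  have vw : dot v w = (nsq dot w)%:C%C.
    rewrite -dotxx [RHS]dotBl (pw (proj_family u v)) ?subr0//.
    exact: proj_family_idem.
  by rewrite projE vw -rmorphM cw scale1r /w addrC subrK.
by rewrite projE uL// pw ?uL// mulr0 scale0r addr0.
Qed.

(** The range of [T] lies in the span of an orthonormal family [u].  There [T] acts by the
    normal matrix [M], whose unitary diagonalization gives the eigenvectors; [T]
    vanishes on the orthogonal complement of its range. *)
Lemma antiherm_eigen T : antiherm T -> finite_rank T ->
  exists k (lam : 'I_k -> R[i]) (e : 'I_k -> V), [/\ orthonormal_family e,
    forall i, T (e i) = lam i *: e i &
    forall x, (forall i, dot x (e i) = 0) -> T x = 0].
Proof.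
move=> kT [k' [b bT]].
have [k [u [ou ub]]] := orthonormal_span [seq b i | i <- enum 'I_k'].
have TG := antiherm_adjoint kT.
have uT x : proj_family u (T x) = T x.
  have [c ->] := bT x; rewrite (adjoint_sum (G := proj_family u)); last exact: dot_proj_family.
  apply: eq_bigr => i _; rewrite ub//; apply: map_f; exact: mem_enum.
pose M : 'M[R[i]]_k := \matrix_(i, j) dot (T (u i)) (u j).
have MT : (M ^t Num.conj)%sesqui = - M.
  apply/matrixP => i j; rewrite !mxE kT rmorphN /=.
  by congr (- _); exact/esym/dotC.
have Mn : M \is normalmx.
  by apply/normalmxP; rewrite MT mulNmx mulmxN.
have /orthomx_spectralP := Mn.
set P := spectralmx M; set d := spectral_diag M => MP.
have PU : P \is unitarymx := spectral_unitarymx M.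
have PM : P *m M = diag_mx d *m P.
  by rewrite {1}MP !mulmxA mulmxV ?mul1mx// unitarymx_unit.
pose e (i : 'I_k) := \sum_j P i j *: u j.
have Tu i : T (u i) = \sum_j M i j *: u j.
  by rewrite -[LHS]uT; apply: eq_bigr => j _; rewrite mxE.
exists k, (fun i => d 0 i), e; split.
- move=> i j; rewrite /e dot_suml.
  have /unitarymxP/matrixP/(_ i j) := PU; rewrite !mxE => <-.
  apply: eq_bigr => l _; rewrite dotZl dot_sumr (bigD1 l)//= big1 ?addr0.
    by rewrite dotZr ou eqxx mulr1 !mxE.
  by move=> l' /negbTE ll; rewrite dotZr ou eq_sym ll mulr0.
- move=> i; rewrite (adjoint_sum _ _ _ _ TG) scaler_sumr.
  rewrite (eq_bigr (fun j => \sum_l (P i j * M j l) *: u l)); last first.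
    by move=> j _; rewrite Tu scaler_sumr; apply: eq_bigr => l _; rewrite scalerA.
  rewrite exchange_big /=; apply: eq_bigr => l _; rewrite -scaler_suml.
  have /matrixP/(_ i l) := PM; rewrite mul_diag_mx !mxE => ->.
  by rewrite scalerA.
- move=> x xe; have xu i : dot x (u i) = 0.
    have -> : u i = \sum_j (invmx P) i j *: e j.
      rewrite (eq_bigr (fun j => \sum_l (invmx P i j * P j l) *: u l)); last first.
        by move=> j _; rewrite scaler_sumr; apply: eq_bigr => l _; rewrite scalerA.
      rewrite exchange_big /= (eq_bigr (fun l => (1%:M : 'M[R[i]]_k) i l *: u l)).
        rewrite (bigD1 i)//= big1 ?addr0 ?mxE ?eqxx ?scale1r// => l li.
        by rewrite mxE eq_sym (negbTE li) scale0r.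
      move=> l _; rewrite -scaler_suml; congr (_ *: _).
      by rewrite -(mulVmx (unitarymx_unit PU)) mxE.
    by rewrite dot_sumr big1// => j _; rewrite dotZr xe mulr0.
  rewrite -uT /proj_family big1// => i _.
  rewrite kT Tu dot_sumr big1 ?oppr0 ?scale0r// => j _.
  by rewrite dotZr xu mulr0.
Qed.

End Spectral.

(** * The norm of the ideal as a supremum over Bessel families *)

Lemma sort_ge_ord (R : realType) k (g : 'I_k -> R) : exists sigma : 'I_k -> 'I_k,
  injective sigma /\
  sort (fun x y => y <= x) [seq g i | i <- enum 'I_k] = [seq g (sigma i) | i <- enum 'I_k].
Proof.
pose r : rel 'I_k := relpre g (fun x y => y <= x).
exists (tnth (sort_tuple r (ord_tuple k))); split.
  by apply/tuple_uniqP; rewrite /= sort_uniq enum_uniq.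
by rewrite sort_map [RHS](map_comp g (tnth (sort_tuple r (ord_tuple k)))) map_tnth_enum.
Qed.

Section SingularValues.
Variables (R : realType) (V : lmodType R[i]) (dot : {dot V for @conjc R}).
Implicit Types (x y z : V) (F T : V -> V) (pi t : nat -> R).

(** Any listing of the singular values, in whatever order, comes from a decomposition
    with nonincreasing [t].  For nonincreasing [pi], Ky Fan's inequality applied to two
    such decompositions shows that [Phi pi s] depends on the operator only. *)
Lemma singular_schmidt F (s : seq R) : singular_values dot F s ->
  exists (t : nat -> R) (e f : 'I_(size s) -> V),
  [/\ (forall i, t i.+1 <= t i) /\ (forall i, 0 <= t i), schmidt_form dot F t e f,
    forall i, dot (F (e i)) (f i) = (t i)%:C%C,
    forall i, f i = (t i)^-1%:C%C *: F (e i)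
  & forall pi, Phi pi s = \sum_(i < size s) pi i * t i].
Proof.
move=> [s0 [G [e0 [FG e0o GF F0]]]].
have [sigma [sinj sE]] := sort_ge_ord (fun i : 'I_(size s) => s`_i).
pose t n := oapp (fun i => s`_(sigma i)) 0 (insub n : option 'I_(size s)).
have tE (i : 'I_(size s)) : t i = s`_(sigma i) by rewrite /t valK.
pose e i := e0 (sigma i).
pose f (i : 'I_(size s)) := (t i)^-1%:C%C *: F (e i).
have t0 n : 0 <= t n by rewrite /t; case: insubP => //= i _ _; exact: s0.
have eo : orthonormal_family dot e.
  by move=> i j; rewrite e0o (inj_eq sinj).
have FF i j : dot (F (e i)) (F (e j)) = (i == j)%:R * (t i ^+ 2)%:C%C.
  rewrite FG GF dotZr conjc_real eo tE mulrC.
  by case: eqVneq => [->//|_]; rewrite !mul0r.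
have Ff i : F (e i) = (t i)%:C%C *: f i.
  rewrite scalerA -rmorphM; have [ti|ti] := eqVneq (t i) 0; last first.
    by rewrite divff// scale1r.
  rewrite ti mul0r scale0r; apply/eqP; rewrite -(nsq_eq0 dot).
  by rewrite /nsq FF ti expr0n mulr0.
have nonneg_perm :
    [seq `|r| | r <- s] = [seq s`_(i : 'I_(size s)) | i <- enum 'I_(size s)].
  rewrite -[s in map _ s](mkseq_nth 0) /mkseq -val_enum_ord -!map_comp.
  by apply: eq_map => i /=; rewrite ger0_norm.
have sortE (i : 'I_(size s)) : (sort (fun x y : R => y <= x) [seq `|r| | r <- s])`_i = t i.
  rewrite nonneg_perm sE (nth_map i) ?size_enum_ord//.
  by rewrite nth_ord_enum tE.
exists t, e, f; split.
- split=> // n; rewrite {1}/t; case: insubP => [j nj jE|_] /=; last exact: t0.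
  have n' : (n < size s)%N by exact: ltnW.
  rewrite -tE jE -[n]/(val (Ordinal n')) -(sortE (Ordinal n')) -jE -(sortE j).
  have srt : sorted (fun x y : R => y <= x)
      (sort (fun x y : R => y <= x) [seq `|r| | r <- s]).
    by apply: sort_sorted => a b; exact: le_total.
  apply: (sorted_ltn_nth (leT := fun x y : R => y <= x) _ 0 srt).
  - by move=> b a c ab bc; exact: le_trans bc ab.
  - by rewrite inE size_sort size_map.
  - by rewrite inE size_sort size_map.
  - by rewrite jE.
- split.
  + exact: orthonormal_bessel.
  + apply: bessel_orthogonal => [i j /negbTE ij|i].
      by rewrite dotZl dotZr FF ij mul0r !mulr0.
    rewrite nsqZ /nsq FF eqxx mul1r /sqc /= expr0n addr0 -exprMn.
    have [->|ti] := eqVneq (t i) 0; first by rewrite mulr0 expr0n.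
    by rewrite mulVf ?expr1n.
  + move=> x; pose y := proj_family dot e x.
    have xy : F (x - y) = 0.
      apply: F0 => i; have [j <-] : exists j, sigma j = i.
        by have [sigma' _ sK] := injF_bij sinj; exists (sigma' i).
      by rewrite dotBl (proj_familyP j x eo) subrr.
    have Fy : F y = \sum_(i < size s) ((t i)%:C%C * dot x (e i)) *: f i.
      rewrite /y /proj_family (adjoint_sum _ _ _ _ FG); apply: eq_bigr => i _.
      by rewrite Ff scalerA mulrC.
    rewrite -Fy -[in LHS](subrK y x) -[x - y]scale1r (adjoint_linear FG).
    by rewrite xy scaler0 add0r.
- move=> i; rewrite dotZr FF eqxx mul1r conjc_real -rmorphM /=.
  have [->|ti] := eqVneq (t i) 0; first by rewrite invr0 mul0r.
  by rewrite expr2 mulrA mulVf// mul1r.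
- by [].
- by move=> pi; apply: eq_bigr => i _; rewrite sortE.
Qed.

(** An eigenvalue [l] of [T] is imaginary, hence [T^* T = - T^2] has eigenvalue
    [- l^2 = |l|^2] on the same vector. *)
Lemma antiherm_singular_values T : antiherm dot T -> finite_rank T ->
  exists s, singular_values dot T s.
Proof.
move=> kT fT; have [k [lam [e [oe Te T0]]]] := antiherm_eigen kT fT.
pose t n := oapp (fun i => Num.sqrt (sqc (lam i))) 0 (insub n : option 'I_k).
pose c := cast_ord (size_mkseq t k).
have tE (i : 'I_(size (mkseq t k))) : (mkseq t k)`_i = Num.sqrt (sqc (lam (c i))).
  have ik : (i < k)%N by rewrite -[ltnRHS](size_mkseq t k).
  rewrite nth_mkseq// /t insubT /=; congr (Num.sqrt (sqc (lam _))).
  exact: val_inj.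
exists (mkseq t k); split=> [i|].
  by rewrite tE sqrtr_ge0.
exists (fun x => - T x), (e \o c); split.
- exact: antiherm_adjoint.
- by move=> i j; rewrite /= oe (inj_eq (@cast_ord_inj _ _ _)).
- move=> i /=; rewrite Te; have TG := antiherm_adjoint kT.
  rewrite (adjointZ _ _ TG).
  rewrite Te scalerA -scaleNr tE sqr_sqrtr ?sqc_ge0//; congr (_ *: _).
  have := kT (e (c i)) (e (c i)); rewrite Te dotZl dotZr oe eqxx !mulr1 => lc.
  by rewrite -mulcJE {2}lc mulrN opprK.
- move=> x h; apply: T0 => i; have := h (cast_ord (esym (size_mkseq t k)) i).
  by rewrite /= /c cast_ord_comp cast_ord_id.
Qed.

Lemma finrank_proj_span (L : seq V) :
  exists2 P : {linear V -> V}, finrank_proj dot P & forall v, v \in L -> P v = v.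
Proof.
have [k [u [ou uL]]] := orthonormal_span dot L.
have lin : GRing.linear_for *:%R (proj_family dot u).
  exact: (adjoint_linear (dot_proj_family dot u)).
pose P : {linear V -> V} := HB.pack (proj_family dot u)
  (GRing.isLinear.Build _ _ _ _ (proj_family dot u) lin).
exists P => //; split=> [|x y|x].
- by exists k, u => x; exists (fun i => dot x (u i)).
- exact: dot_proj_family.
- exact: proj_family_idem.
Qed.

(** From left to right, compress by a projection [P] with [P T = T] and use Ky Fan's
    inequality.  From right to left, the Schmidt vectors of [P T] are test families:
    the second one lies in the range of [P], so that [P] disappears from the
    scalar products. *)
Lemma op_norm_le_dual pi T (c : R) : (forall i, pi i.+1 <= pi i) ->
  (forall i, 0 <= pi i) -> antiherm dot T -> finite_rank T -> 0 <= c ->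
  (op_norm dot pi T <= c%:E)%E <-> dual_le dot pi T c.
Proof.
move=> npi pi0 kT fT c0; split=> [Tc|Tc].
- have [P PP PT] : exists2 P : {linear V -> V}, finrank_proj dot P & P \o T = T.
    have [k [b bT]] := fT.
    have [P PP Pb] := finrank_proj_span [seq b i | i <- enum 'I_k].
    exists P => //; apply/funext => x /=; have [a ->] := bT x.
    rewrite linear_sum; apply: eq_bigr => i _.
    by rewrite linearZ /= Pb// map_f ?mem_enum.
  have [s0 Ts0] := antiherm_singular_values kT fT.
  have : (finrank_norm dot pi (P \o T))%:E%E \in
    [set (finrank_norm dot pi (P \o T))%:E%E | P in finrank_proj dot].
    by rewrite inE; exists P.
  rewrite inE => /ereal_sup_ubound/le_trans/(_ Tc); rewrite lee_fin PT.
  rewrite /finrank_norm; case: xgetP => [_ _ [s Ts <-]|]; last first.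
    by move=> /(_ (Phi pi s0)) h; exfalso; apply: h; exists s0.
  have [t [e [f [[nt t0] TE _ _ sE]]]] := singular_schmidt Ts.
  rewrite sE => tc k e' f' be bf; apply: le_trans tc.
  exact: (schmidt_dual_le npi pi0 nt t0 TE).
- apply: ge_ereal_sup => _ [P [_ PA PI] <-]; rewrite lee_fin /finrank_norm.
  case: xgetP => [_ _ [s Ts <-]|//].
  have [t [e [f [[nt t0] [be bf _] dPf fE sE]]]] := singular_schmidt Ts.
  rewrite sE; apply: le_trans (Tc _ e f be bf); apply: ler_sum => i _.
  apply: ler_wpM2l => //.
  have -> : f i = P (f i) by rewrite fE linearZ /= PI.
  by rewrite -PA (dPf i).
Qed.

End SingularValues.

(** * Approximate units with small commutators *)

Section PositiveContractions.
Variables (R : realType) (V : lmodType R[i]) (dot : {dot V for @conjc R}).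
Implicit Types (x y z : V) (A B P : {linear V -> V}) (T : V -> V).

Lemma Re_dot_le x y : 2 * Re (dot x y) <= nsq dot x + nsq dot y.
Proof. by have := nsq_ge0 dot (x - y); rewrite nsqB; lra. Qed.

Lemma le_dotxx x y : (dot x x <= dot y y) = (nsq dot x <= nsq dot y).
Proof. by rewrite !dotxx lecR. Qed.

(** Polarization along [x + y] and [x + i y]. *)
Lemma positive_adjoint A : (forall x, 0 <= dot (A x) x) -> is_adjoint dot A A.
Proof.
move=> A0 x y.
have AI u : Im (dot (A u) u) = 0 by exact/ger0_Im/A0.
rewrite [RHS]dotC.
have h1 := AI (x + y); have h2 := AI (x + Complex 0 1 *: y).
have hx := AI x; have hy := AI y.
move: h1 h2; rewrite !(linearD A) (linearZ_LR A) /= !dotDl !dotDr !dotZl !dotZr.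
move: hx hy; case: (dot (A x) x) => [a b]; case: (dot (A y) y) => [c d].
case: (dot (A x) y) => [p q]; case: (dot (A y) x) => [p' q'] /=.
move=> -> -> h1 h2; congr Complex; lra.
Qed.

Lemma R1plus_adjoint A : R1plus dot A -> is_adjoint dot A A.
Proof. by case=> _ A0 _; exact: positive_adjoint. Qed.

Lemma R1plus_nsq A x : R1plus dot A -> nsq dot (A x) <= nsq dot x.
Proof. by case=> _ _ A1; rewrite -le_dotxx. Qed.

Lemma dot_proj P x : finrank_proj dot P -> dot (P x) x = dot (P x) (P x).
Proof. by move=> [_ PA PI]; rewrite [RHS]PA PI -PA. Qed.

Lemma finrank_proj_R1plus P : finrank_proj dot P -> R1plus dot P.
Proof.
move=> PP; have [fP PA PI] := PP; split=> // x.
  by rewrite dot_proj// dot_ge0.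
rewrite le_dotxx; have := nsq_ge0 dot (x - P x).
by rewrite nsqB Re_dotC dot_proj// -/(nsq dot _); lra.
Qed.

(** [B = P B P], and the contraction [B] is below the identity. *)
Lemma op_le_proj B P : R1plus dot B -> finrank_proj dot P ->
  (forall x, P (B x) = B x) -> op_le dot B P.
Proof.
move=> B1 PP PB x; have [_ PA PI] := PP; have BA := R1plus_adjoint B1.
have -> : dot (B x) x = dot (B (P x)) (P x).
  by rewrite -{1}PB PA BA -[in LHS]PB -PA -BA.
rewrite (dot_proj x PP); have [_ /(_ (P x)) + _] := B1.
set y := P x; rewrite dotxx.
have := Re_dot_le (B y) y; have := R1plus_nsq y B1.
case: (dot (B y) y) => a b; rewrite !lecE /= => h1 h2 /andP[/eqP-> _].
by rewrite eqxx /=; lra.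
Qed.

(** [Re <A v, v> >= |v|^2] and [|A v| <= |v|] force equality in the Cauchy-Schwarz
    inequality. *)
Lemma op_le_proj_fix P A v : finrank_proj dot P -> R1plus dot A ->
  op_le dot P A -> P v = v -> A v = v.
Proof.
move=> PP A1 /(_ v) PA Pv; apply/eqP; rewrite -subr_eq0 -(nsq_eq0 dot).
rewrite eq_le nsq_ge0 andbT nsqB.
move: PA; rewrite Pv dotxx lecE /= => /andP[_].
by have := R1plus_nsq v A1; lra.
Qed.

(** The list is the same for every [S]; it is used with the identity and with the
    [tau j], to enlarge a finite-dimensional space by its images under [tau]. *)
Lemma finite_rank_fix T : finite_rank T -> exists L : seq V,
  forall S G, is_adjoint dot S G -> forall P,
  (forall v, v \in L -> P (S v) = S v) -> forall x, P (S (T x)) = S (T x).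
Proof.
move=> [k [b bT]]; exists [seq b i | i <- enum 'I_k] => S G SG P Pb x.
have [c ->] := bT x; rewrite (adjoint_sum _ _ _ _ SG) linear_sum.
by apply: eq_bigr => i _; rewrite linearZ /= Pb// map_f ?mem_enum.
Qed.

Lemma finite_rank_proj P T : finite_rank P -> (forall x, P (T x) = T x) -> finite_rank T.
Proof.
by move=> [k [b bP]] PT; exists k, b => x; have [c cE] := bP (T x); exists c; rewrite -PT.
Qed.

Lemma commutator_antiherm A T : R1plus dot A -> is_adjoint dot T T ->
  antiherm dot (commutator A T).
Proof.
move=> /R1plus_adjoint AA TT x y.
by rewrite /commutator dotBl dotBr AA !TT AA opprB.
Qed.

Lemma adjoint_id : is_adjoint dot id id.
Proof. by []. Qed.

Lemma commutator_finite_rank A T : R1plus dot A -> is_adjoint dot T T ->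
  finite_rank (commutator A T).
Proof.
move=> [fA _ _] TT.
have [L LP] := finite_rank_fix fA.
have [P [fP _ _] PL] := finrank_proj_span dot (L ++ [seq T v | v <- L]).
apply: (finite_rank_proj fP) => x; rewrite /commutator linearB /=.
congr (_ - _).
  by apply: (LP _ _ adjoint_id) => v vL; rewrite PL// mem_cat vL.
by apply: (LP _ _ TT) => v vL; rewrite PL// mem_cat map_f ?orbT.
Qed.

Definition midpoint A B : {linear V -> V} := (2^-1 : R)%:C%C \*: (A \+ B).

Lemma midpointE A B x : midpoint A B x = (2^-1 : R)%:C%C *: (A x + B x).
Proof. by []. Qed.

Lemma dot_midpoint A B x y :
  dot (midpoint A B x) y = (2^-1 : R)%:C%C * (dot (A x) y + dot (B x) y).
Proof. by rewrite midpointE dotZl dotDl. Qed.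

Lemma midpoint_R1plus A B : R1plus dot A -> R1plus dot B ->
  R1plus dot (midpoint A B).
Proof.
move=> A1 B1; have [fA A0 _] := A1; have [fB B0 _] := B1; split.
- have [LA LAP] := finite_rank_fix fA; have [LB LBP] := finite_rank_fix fB.
  have [P [fP _ _] PL] := finrank_proj_span dot (LA ++ LB).
  apply: (finite_rank_proj fP) => x; rewrite midpointE linearZ linearD /=.
  by rewrite (LAP _ _ adjoint_id) ?(LBP _ _ adjoint_id)// => v vL;
    rewrite PL// mem_cat vL ?orbT.
- move=> x; rewrite dot_midpoint mulr_ge0 ?addr_ge0//.
  by rewrite ler0c invr_ge0.
- move=> x; rewrite le_dotxx midpointE nsqZ nsqD /sqc /= expr0n addr0.
  have := R1plus_nsq x A1; have := R1plus_nsq x B1.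
  have := Re_dot_le (A x) (B x); lra.
Qed.

Lemma op_le_midpoint A B C : op_le dot C A -> op_le dot C B ->
  op_le dot C (midpoint A B).
Proof.
move=> CA CB x; have := CA x; have := CB x.
rewrite dot_midpoint; case: (dot (C x) x) => a b; case: (dot (A x) x) => c d.
case: (dot (B x) x) => c' d'; rewrite !lecE /= => /andP[/eqP-> ?] /andP[/eqP-> ?].
by apply/andP; split; [apply/eqP; lra|lra].
Qed.

Lemma op_le_trans A B C : op_le dot A B -> op_le dot B C -> op_le dot A C.
Proof. by move=> AB BC x; exact: le_trans (AB x) (BC x). Qed.

End PositiveContractions.

Section NormalizedCommutators.
Variables (R : realType) (V : lmodType R[i]) (dot : {dot V for @conjc R}).
Variables (n : nat) (tau : 'I_n -> V -> V) (pi : nat -> R).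
Hypothesis tauA : forall j, is_adjoint dot (tau j) (tau j).
Hypothesis pi_anti : forall i, pi i.+1 <= pi i.
Hypothesis pi_gt0 : forall i, 0 < pi i.
Implicit Types (x y z : V) (A B P : {linear V -> V}) (T : V -> V) (c delta : R).

(** [k_pi(tau) <= c], with the directed lower limit spelled out in terms of [dual_le]. *)
Definition qc_bound c := forall B, R1plus dot B -> forall eps : R, 0 < eps ->
  exists A, [/\ R1plus dot A, op_le dot B A &
    forall j, dual_le dot pi (commutator A (tau j)) (c + eps)].

Lemma qc_modulus_le c : 0 <= c ->
  (qc_modulus dot pi tau <= c%:E)%E <-> qc_bound c.
Proof.
move=> c0; have pi0 i : 0 <= pi i by exact: ltW.
have normE A (a : R) : R1plus dot A -> 0 <= a ->
    (tuple_norm dot pi (fun i => commutator A (tau i)) <= a%:E)%E <->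
    forall j, dual_le dot pi (commutator A (tau j)) a.
  move=> A1 a0; have dE j := op_norm_le_dual pi_anti pi0
    (commutator_antiherm A1 (tauA j)) (commutator_finite_rank A1 (tauA j)) a0.
  split=> [/bigmax_leP[_ h] j|h]; first exact/dE/h.
  by apply/bigmax_leP; split=> [|j _]; [rewrite lee_fin|exact/dE/h].
split=> [qc B B1 eps e0|qc].
- have : (ereal_inf [set tuple_norm dot pi (fun i => commutator A (tau i)) |
      A in [set A | R1plus dot A /\ op_le dot B A]] < (c + eps)%:E)%E.
    apply: (@le_lt_trans _ _ c%:E); last by rewrite lte_fin ltrDl.
    apply: le_trans qc; apply: ereal_sup_ubound; by exists B.
  move=> /ereal_inf_lt[_ [A [A1 BA] <-] /ltW Ac]; exists A; split => //.
  by apply/normE => //; rewrite addr_ge0// ltW.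
- apply: ge_ereal_sup => _ [B B1 <-]; apply/lee_addgt0Pr => eps e0.
  have [A [A1 BA Ac]] := qc B B1 eps e0.
  apply: (@le_trans _ _ (tuple_norm dot pi (fun i => commutator A (tau i)))).
    by apply: ereal_inf_lbound; exists A.
  by rewrite -EFinD; apply/normE => //; rewrite addr_ge0// ltW.
Qed.

(** The operator norm bound [|T| <= delta]; replacing [|x| |y|] by the arithmetic mean of
    the squares makes it additive over orthogonal decompositions. *)
Definition form_le T delta :=
  forall x y, Re (dot (T x) y) <= delta * ((nsq dot x + nsq dot y) / 2).

(** The largest singular value has weight [pi 0]: test with one-element families. *)
Lemma dual_form_le T T' c : is_adjoint dot T T' -> 0 <= c ->
  dual_le dot pi T c -> form_le T (c / pi 0%N).
Proof.
move=> TT c0 Tc x y.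
have d0 : 0 <= c / pi 0%N by rewrite divr_ge0// ltW.
have rhs0 : 0 <= c / pi 0%N * ((nsq dot x + nsq dot y) / 2).
  by rewrite mulr_ge0// divr_ge0// addr_ge0 ?nsq_ge0.
have [->|x0] := eqVneq x 0.
  by rewrite (adjoint0 TT) dot0l; rewrite mulr_ge0// divr_ge0// addr_ge0 ?nsq_ge0.
have [->|y0] := eqVneq y 0.
  by rewrite dot0r; rewrite mulr_ge0// divr_ge0// addr_ge0 ?nsq_ge0.
have nz z : z != 0 -> exists2 a : R, 0 < a & a ^+ 2 = nsq dot z.
  move=> z0; have nz0 : 0 < nsq dot z by rewrite lt0r nsq_eq0 z0 nsq_ge0.
  by exists (Num.sqrt (nsq dot z)); rewrite ?sqrtr_gt0// sqr_sqrtr// ltW.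
have [a a0 ax] := nz x x0; have [b b0 bY] := nz y y0.
have unit z (r : R) : 0 < r -> r ^+ 2 = nsq dot z -> nsq dot (r^-1%:C%C *: z) <= 1.
  move=> r0 rz; rewrite nsqZ -rz /sqc /= expr0n addr0 -exprMn.
  by rewrite mulVf ?expr1n// gt_eqF.
have := Tc _ _ _ (bessel1 (unit x a a0 ax)) (bessel1 (unit y b b0 bY)).
rewrite big_ord1 (adjointZ _ _ TT) dotZl dotZr conjc_real ReZ ReZ.
rewrite -ax -bY; set r := Re _ => h.
have -> : r = a * b * (a^-1 * (b^-1 * r)).
  by field; rewrite !gt_eqF.
have h' : a^-1 * (b^-1 * r) <= c / pi 0%N.
  by rewrite ler_pdivlMr// mulrC.
apply: le_trans (ler_wpM2l _ h') _; first by rewrite mulr_ge0// ltW.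
rewrite mulrC; apply: ler_wpM2l => //.
have := sqr_ge0 (a - b); nra.
Qed.

Lemma commutator_adjoint A j : R1plus dot A ->
  is_adjoint dot (commutator A (tau j)) (fun x => - commutator A (tau j) x).
Proof. by move=> A1; apply/antiherm_adjoint/commutator_antiherm. Qed.

Lemma commutator_midpoint A B j x : commutator (midpoint A B) (tau j) x =
  (2^-1 : R)%:C%C *: (commutator A (tau j) x + commutator B (tau j) x).
Proof.
rewrite /commutator !midpointE (adjointZ _ _ (tauA j)) (adjointD _ _ (tauA j)).
by rewrite -scalerBr opprD addrACA.
Qed.

(** Let the projection [Q] fix the ranges of all the [[A1, tau j]], and let [A2] be the
    identity on the range of [Q] and on its images under the [tau j].  Then
    [[A2, tau j] Q = 0], so the two commutators act on orthogonal subspaces and their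
    average has at most half of the larger operator norm. *)
Lemma qc_bound_halve c delta : 0 <= delta ->
  (forall B, R1plus dot B -> forall eps : R, 0 < eps -> exists A,
    [/\ R1plus dot A, op_le dot B A,
        forall j, dual_le dot pi (commutator A (tau j)) (c + eps) &
        forall j, form_le (commutator A (tau j)) (delta + eps)]) ->
  forall B, R1plus dot B -> forall eps : R, 0 < eps -> exists A,
    [/\ R1plus dot A, op_le dot B A,
        forall j, dual_le dot pi (commutator A (tau j)) (c + eps) &
        forall j, form_le (commutator A (tau j)) (delta / 2 + eps)].
Proof.
move=> d0 h B B1 eps e0.
have [A1 [A11 BA1 c1 d1]] := h B B1 eps e0.
have [fA1 _ _] := A11; have [fB _ _] := B1.
have [L LP] := finite_rank_fix dot fA1; have [LB LBP] := finite_rank_fix dot fB.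
pose L1 := L ++ [seq tau j v | j <- enum 'I_n, v <- L].
have [Q QP QL] := finrank_proj_span dot L1.
have [fQ QA QI] := QP; have [LQ LQP] := finite_rank_fix dot fQ.
pose L2 := LQ ++ [seq tau j v | j <- enum 'I_n, v <- LQ] ++ LB.
have [P PP PL] := finrank_proj_span dot L2.
have P1 := finrank_proj_R1plus PP.
have BP : op_le dot B P.
  apply: op_le_proj => //; apply: (LBP _ _ (adjoint_id dot)) => v vL.
  by apply: PL; rewrite !mem_cat vL !orbT.
have [A2 [A21 PA2 c2 d2]] := h P P1 eps e0.
have A2fix v : P v = v -> A2 v = v by exact: op_le_proj_fix PP A21 PA2.
exists (midpoint A1 A2); split.
- exact: midpoint_R1plus.
- by apply: op_le_midpoint => //; exact: op_le_trans BP PA2.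
- move=> j k e f be bf; have := c1 j k e f be bf; have := c2 j k e f be bf.
  set S1 := \sum_(_ < _) _; set S2 := \sum_(_ < _) _ => h1 h2.
  rewrite [leLHS](_ : _ = 2^-1 * (S1 + S2)); first by lra.
  rewrite -big_split mulr_sumr; apply: eq_bigr => i _ /=.
  by rewrite commutator_midpoint dotZl dotDl ReZ ReD; ring.
- move=> j.
  have T1A := commutator_adjoint j A11; have T2A := commutator_adjoint j A21.
  have T1x x : Q (commutator A1 (tau j) x) = commutator A1 (tau j) x.
    rewrite /commutator linearB /=; congr (_ - _).
      by apply: (LP _ _ (adjoint_id dot)) => v vL; rewrite QL// mem_cat vL.
    apply: (LP _ _ (tauA j)) => v vL; apply: QL; rewrite mem_cat; apply/orP; right.
    by apply/allpairsP; exists (j, v); rewrite mem_enum.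
  have T2Q x : commutator A2 (tau j) (Q x) = 0.
    rewrite /commutator !A2fix ?subrr//.
      apply: (LQP _ _ (adjoint_id dot)) => v vL; apply: PL.
      by rewrite mem_cat vL.
    apply: (LQP _ _ (tauA j)) => v vL; apply: PL.
    rewrite !mem_cat; apply/orP; right; apply/orP; left.
    by apply/allpairsP; exists (j, v); rewrite mem_enum.
  have T1k := commutator_antiherm A11 (tauA j).
  have T2k := commutator_antiherm A21 (tauA j).
  have split_nsq x : nsq dot x = nsq dot (Q x) + nsq dot (x - Q x).
    by rewrite nsqB Re_dotC dot_proj// -/(nsq dot _); ring.
  have T1split x y : dot (commutator A1 (tau j) x) y =
      dot (commutator A1 (tau j) (Q x)) (Q y).
    by rewrite -T1x QA T1k -T1x -QA -T1k.
  have T2split x y : dot (commutator A2 (tau j) x) y =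
      dot (commutator A2 (tau j) (x - Q x)) (y - Q y).
    have QT z w : dot (commutator A2 (tau j) w) (Q z) = 0.
      by rewrite T2k T2Q dot0r oppr0.
    rewrite [RHS]dotBr QT subr0.
    have -> // : commutator A2 (tau j) x = commutator A2 (tau j) (x - Q x).
    by rewrite -[in LHS](subrK (Q x) x) (adjointD (x - Q x) (Q x) T2A) T2Q addr0.
  move=> x y; rewrite commutator_midpoint dotZl ReZ dotDl ReD T1split T2split.
  have := d1 j (Q x) (Q y); have := d2 j (x - Q x) (y - Q y).
  rewrite (split_nsq x) (split_nsq y).
  have := nsq_ge0 dot (Q x); have := nsq_ge0 dot (x - Q x).
  have := nsq_ge0 dot (Q y); have := nsq_ge0 dot (y - Q y).
  move: (Re _) (Re _) (nsq _ _) (nsq _ _) (nsq _ _) (nsq _ _) => u1 u2 a b a' b'.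
  nra.
Qed.

(** Iterated halving, starting from the bound of [dual_form_le]. *)
Lemma qc_bound_small c : 0 <= c -> qc_bound c ->
  forall B, R1plus dot B -> forall eps delta : R, 0 < eps -> 0 < delta -> exists A,
    [/\ R1plus dot A, op_le dot B A,
        forall j, dual_le dot pi (commutator A (tau j)) (c + eps) &
        forall j, form_le (commutator A (tau j)) delta].
Proof.
move=> c0 qc.
have step k : forall B, R1plus dot B -> forall eps : R, 0 < eps -> exists A,
    [/\ R1plus dot A, op_le dot B A,
        forall j, dual_le dot pi (commutator A (tau j)) (c + eps) &
        forall j, form_le (commutator A (tau j)) ((c + 1) / pi 0%N / 2 ^+ k + eps)].
  elim: k => [|k IH].
    move=> B B1 eps e0; have m0 : 0 < Num.min eps 1 by rewrite lt_min e0 ltr01.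
    have [A [A1 BA Ac]] := qc B B1 _ m0; exists A; split => // j.
      move=> k e f be bf; apply: le_trans (Ac j k e f be bf) _.
      by rewrite lerD2l ge_min lexx.
    have c1 : 0 <= c + Num.min eps 1 by rewrite addr_ge0// ltW.
    move=> x y; apply: le_trans (dual_form_le (commutator_adjoint j A1) c1 (Ac j) x y) _.
    apply: ler_wpM2r; first by rewrite divr_ge0// addr_ge0 ?nsq_ge0.
    rewrite expr0 divr1 ler_wpDr ?(ltW e0)//; apply: ler_wpM2r.
      by rewrite invr_ge0 ltW.
    by rewrite lerD2l ge_min lexx orbT.
  move=> B B1 eps e0.
  have [|A [A1 BA Ac Ad]] := qc_bound_halve _ IH B1 e0.
    by rewrite divr_ge0 ?exprn_ge0// divr_ge0 ?addr_ge0// ltW.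
  by exists A; split => //; rewrite exprSr invfM mulrA.
move=> B B1 eps delta e0 d0.
have C0 : 0 <= (c + 1) / pi 0%N by rewrite divr_ge0 ?addr_ge0// ltW.
have [k kd] : exists k, (c + 1) / pi 0%N / 2 ^+ k <= delta / 2.
  have C1 : 0 < delta / 2 / ((c + 1) / pi 0%N + 1).
    by rewrite !divr_gt0// ltr_wpDl.
  have [k _ /(_ k (leqnn k)) h] := near_infty_natSinv_expn_lt (PosNum C1).
  exists k; move: h => /=; rewrite div1r ltr_pdivlMr ?ltr_wpDl// => h.
  rewrite mulrC; apply: le_trans (ltW h).
  by apply: ler_wpM2l; rewrite ?invr_ge0 ?exprn_ge0// lerDl.
have m0 : 0 < Num.min eps (delta / 2) by rewrite lt_min e0 divr_gt0.
have [A [A1 BA Ac Ad]] := step k B B1 _ m0; exists A; split => // j.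
  move=> p e f be bf; apply: le_trans (Ac j p e f be bf) _.
  by rewrite lerD2l ge_min lexx.
move=> x y; apply: le_trans (Ad j x y) _; apply: ler_wpM2r.
  by rewrite divr_ge0// addr_ge0 ?nsq_ge0.
have : Num.min eps (delta / 2) <= delta / 2 by rewrite ge_min lexx orbT.
lra.
Qed.

End NormalizedCommutators.

(** * Ampliation and partial trace *)

Section BlockIndices.
Variables (k m : nat).

Lemma ltn_block_quot (l : 'I_(k * m)) : (l %/ m < k)%N.
Proof.
rewrite ltn_divLR//; case: m l => [|//] l.
by have := ltn_ord l; rewrite [X in (_ < X)%N]muln0.
Qed.

Lemma ltn_block_rem (l : 'I_(k * m)) : (l %% m < m)%N.
Proof.
rewrite ltn_mod; case: m l => [|//] l.
by have := ltn_ord l; rewrite [X in (_ < X)%N]muln0.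
Qed.

(** The [l]-th singular value of an ampliation belongs to the [l %/ m]-th one of the
    operator and to the summand [l %% m]. *)
Definition block_index (l : 'I_(k * m)) : 'I_k * 'I_m :=
  (Ordinal (ltn_block_quot l), Ordinal (ltn_block_rem l)).

Lemma block_indexE (l : 'I_(k * m)) : l = ((block_index l).1 * m + (block_index l).2)%N :> nat.
Proof. exact: divn_eq. Qed.

Lemma block_index_inj : injective block_index.
Proof.
by move=> l l' ll; apply: val_inj; rewrite /= (block_indexE l) (block_indexE l') ll.
Qed.

Lemma block_index_bij : bijective block_index.
Proof.
apply: inj_card_bij; first exact: block_index_inj.
by rewrite card_prod !card_ord.
Qed.

Lemma sum_block_index (U : nmodType) (F : 'I_k * 'I_m -> U) :
  \sum_(l < k * m) F (block_index l) = \sum_(j < k) \sum_(i < m) F (j, i).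
Proof.
rewrite pair_bigA /= [RHS](reindex block_index)/=; last exact/onW_bij/block_index_bij.
exact: eq_bigr.
Qed.

End BlockIndices.

Section AmpliationGeometry.
Variables (R : realType) (V : lmodType R[i]) (dot : {dot V for @conjc R}).
Variable m : nat.
Local Notation W := {ffun 'I_m -> V}.
Local Notation dotW := (ampl_dot dot m : {dot W for @conjc R}).
Implicit Types (x y z : V) (u v w : W) (A B P : {linear V -> V}) (T : V -> V).

Definition slot (i : 'I_m) x : W := [ffun k => if k == i then x else 0].

Lemma ampl_dotE u v : dotW u v = \sum_i dot (u i) (v i).
Proof. by []. Qed.

Lemma dot_slotl i x w : dotW (slot i x) w = dot x (w i).
Proof.
rewrite ampl_dotE (bigD1 i)//= ffunE eqxx big1 ?addr0// => k /negbTE ki.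
by rewrite ffunE ki dot0l.
Qed.

Lemma dot_slotr i x w : dotW w (slot i x) = dot (w i) x.
Proof. by rewrite (dotC dotW) dot_slotl -dotC. Qed.

Lemma nsq_slot i x : nsq dotW (slot i x) = nsq dot x.
Proof. by rewrite /nsq dot_slotl ffunE eqxx. Qed.

Lemma nsq_ampl u : nsq dotW u = \sum_i nsq dot (u i).
Proof. exact: Re_sum. Qed.

Lemma slot_is_linear i (a : R[i]) x y : slot i (a *: x + y) = a *: slot i x + slot i y.
Proof. by apply/ffunP => k; rewrite !ffunE; case: ifP; rewrite ?scaler0 ?addr0. Qed.

Lemma slotZ i (a : R[i]) x : slot i (a *: x) = a *: slot i x.
Proof. by apply/ffunP => k; rewrite !ffunE; case: ifP; rewrite ?scaler0. Qed.

Lemma ampl_sum_slot u : u = \sum_i slot i (u i).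
Proof.
apply/ffunP => k; rewrite sum_ffunE (bigD1 k)//= ffunE eqxx big1 ?addr0// => i.
by rewrite ffunE eq_sym => /negbTE ->.
Qed.

Lemma ampl_adjoint T T' : is_adjoint dot T T' ->
  is_adjoint dotW (ampl m T) (ampl m T').
Proof. by move=> TT u v; apply: eq_bigr => i _; rewrite !ffunE TT. Qed.

Lemma ampl_slot T T' i x : is_adjoint dot T T' -> ampl m T (slot i x) = slot i (T x).
Proof.
move=> TT; apply/ffunP => k; rewrite !ffunE; case: ifP => // _.
exact: adjoint0 TT.
Qed.

Lemma bessel_slot k (e : 'I_k -> V) : bessel dot e ->
  bessel dotW (fun l : 'I_(k * m) => slot (block_index l).2 (e (block_index l).1)).
Proof.
move=> be u; rewrite (sum_block_index (fun p => sqc (dotW u (slot p.2 (e p.1))))).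
rewrite exchange_big nsq_ampl; apply: ler_sum => i _.
rewrite (eq_bigr (fun j => sqc (dot (u i) (e j)))); first exact: be.
by move=> j _; rewrite dot_slotr.
Qed.

Lemma schmidt_ampl T k t (e f : 'I_k -> V) : schmidt_form dot T t e f ->
  schmidt_form dotW (ampl m T) (fun l => t (l %/ m)%N)
    (fun l : 'I_(k * m) => slot (block_index l).2 (e (block_index l).1))
    (fun l : 'I_(k * m) => slot (block_index l).2 (f (block_index l).1)).
Proof.
move=> [be bf TE]; split; [exact: bessel_slot..|] => u.
rewrite (sum_block_index (fun p => ((t p.1)%:C%C *
  dotW u (slot p.2 (e p.1))) *: slot p.2 (f p.1))) exchange_big /=.
rewrite [LHS]ampl_sum_slot; apply: eq_bigr => i _; rewrite ffunE TE.
rewrite (eq_bigr (fun j : 'I_k => slot i (((t j)%:C%C * dot (u i) (e j)) *: f j))); last first.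
  by move=> j _; rewrite dot_slotr slotZ.
apply/ffunP => l; rewrite ffunE sum_ffunE; case: ifP => li.
  by apply: eq_bigr => j _; rewrite ffunE li.
by rewrite big1// => j _; rewrite ffunE li.
Qed.

(** Each block of [m] equal singular values is weighted by at most [m] times its first
    weight. *)
Lemma ampl_dual_le (pi t : nat -> R) T k (e f : 'I_k -> V) :
  (forall i, pi i.+1 <= pi i) -> (forall i, 0 <= pi i) ->
  (forall i, t i.+1 <= t i) -> (forall i, 0 <= t i) -> (0 < m)%N ->
  schmidt_form dot T t e f ->
  dual_le dotW pi (ampl m T) (\sum_(j < k) m%:R * pi (j * m)%N * t j).
Proof.
move=> npi pi0 nt t0 m0 TS p e' f' be bf.
have ntm l : t (l.+1 %/ m)%N <= t (l %/ m)%N.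
  by apply: (nonincreasing_seqP _).1 nt _ _ _; exact: leq_div2r.
apply: le_trans (schmidt_dual_le npi pi0 ntm (fun l => t0 _) (schmidt_ampl TS) be bf) _.
rewrite (eq_bigr (fun l : 'I_(k * m) => (fun q : 'I_k * 'I_m =>
    pi (q.1 * m + q.2)%N * t q.1) (block_index l))); last first.
  by move=> l _; rewrite /= -divn_eq.
rewrite (sum_block_index (fun q => pi (q.1 * m + q.2)%N * t q.1)) /=.
apply: ler_sum => j _; rewrite -mulr_suml; apply: ler_wpM2r => //.
have -> : m%:R * pi (j * m)%N = \sum_(i < m) pi (j * m)%N.
  by rewrite sumr_const card_ord mulr_natl.
apply: ler_sum => i _.
by apply: (nonincreasing_seqP _).1 npi _ _ _; exact: leq_addr.
Qed.

Lemma ampl_is_linear A : GRing.linear_for *:%R (ampl m A).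
Proof. by move=> a u v; apply/ffunP => i; rewrite !ffunE linearP. Qed.

Definition ampl_lin A : {linear W -> W} :=
  HB.pack (ampl m A) (GRing.isLinear.Build _ _ _ _ (ampl m A) (ampl_is_linear A)).

Lemma ampl_linE A u : ampl_lin A u = ampl m A u.
Proof. by []. Qed.

Lemma finite_rank_sum (U : lmodType R[i]) (I : finType) (T : U -> U) (b : I -> U) :
  (forall u : U, exists c : I -> R[i], T u = \sum_i c i *: b i) -> finite_rank T.
Proof.
move=> bT; exists #|I|, (b \o enum_val) => u; have [c ->] := bT u.
exists (c \o enum_val); rewrite (reindex (@enum_val I predT))//.
exact/onW_bij/enum_val_bij.
Qed.

Lemma ampl_R1plus A : R1plus dot A -> R1plus dotW (ampl_lin A).
Proof.
move=> A1; have [[k [b bA]] A0 _] := A1; split.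
- apply: (finite_rank_sum (b := fun p : 'I_m * 'I_k => slot p.1 (b p.2))) => u.
  have [c cE] := choice (fun i => bA (u i)).
  exists (fun p => c p.1 p.2); rewrite [LHS]ampl_sum_slot.
  rewrite -(pair_bigA _ (fun i j => c i j *: slot i (b j))) /=.
  apply: eq_bigr => i _; rewrite ffunE cE.
  apply/ffunP => l; rewrite ffunE sum_ffunE; case: ifP => li.
    by apply: eq_bigr => j _; rewrite !ffunE li.
  by rewrite big1// => j _; rewrite !ffunE li scaler0.
- by move=> u; rewrite ampl_dotE sumr_ge0// => i _; rewrite ffunE A0.
- move=> u; rewrite le_dotxx !nsq_ampl; apply: ler_sum => i _.
  by rewrite ffunE; exact: R1plus_nsq.
Qed.

Lemma ampl_finrank_proj P : finrank_proj dot P -> finrank_proj dotW (ampl_lin P).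
Proof.
move=> PP; have [_ PA PI] := PP.
have [fP _ _] := ampl_R1plus (finrank_proj_R1plus PP).
split=> //; first exact: ampl_adjoint.
by move=> u; apply/ffunP => i; rewrite !ffunE PI.
Qed.

Lemma op_le_ampl A B : op_le dot A B -> op_le dotW (ampl_lin A) (ampl_lin B).
Proof. by move=> AB u; apply: ler_sum => i _; rewrite !ffunE. Qed.

Lemma commutator_ampl A T :
  commutator (ampl_lin A) (ampl m T) = ampl m (commutator A T).
Proof. by apply/funext => u; apply/ffunP => i; rewrite !ffunE. Qed.

(** Ampliated projections are cofinal: take [P] to fix all the components of vectors
    whose span contains the range of [B]. *)
Lemma R1plus_le_ampl (B : {linear W -> W}) : R1plus dotW B ->
  exists2 P : {linear V -> V}, finrank_proj dot P & op_le dotW B (ampl_lin P).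
Proof.
move=> B1; have [fB _ _] := B1; have [L LP] := finite_rank_fix dotW fB.
have [P PP PL] := finrank_proj_span dot [seq u i | u : W <- L, i <- enum 'I_m].
exists P => //; apply: op_le_proj => //; first exact: ampl_finrank_proj.
apply: (LP _ _ (adjoint_id dotW)) => u uL; apply/ffunP => i; rewrite ffunE PL//.
by apply/allpairsP; exists (u, i); rewrite mem_enum.
Qed.

(** Normalized by [1 / m], so that [ampl_lin] followed by it is the identity. *)
Definition partial_trace (A : {linear W -> W}) x : V :=
  (m%:R^-1 : R)%:C%C *: \sum_i A (slot i x) i.

Lemma partial_trace_is_linear (A : {linear W -> W}) : GRing.linear_for *:%R (partial_trace A).
Proof.
move=> a x y; rewrite /partial_trace scalerA [a * _]mulrC -scalerA -scalerDr.
congr (_ *: _); rewrite scaler_sumr -big_split; apply: eq_bigr => i _ /=.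
by rewrite slot_is_linear linearP !ffunE.
Qed.

Definition partial_trace_lin (A : {linear W -> W}) : {linear V -> V} := HB.pack (partial_trace A)
  (GRing.isLinear.Build _ _ _ _ (partial_trace A) (partial_trace_is_linear A)).

Lemma dot_partial_trace (A : {linear W -> W}) x y : dot (partial_trace_lin A x) y =
  (m%:R^-1 : R)%:C%C * \sum_i dotW (A (slot i x)) (slot i y).
Proof.
rewrite /= /partial_trace dotZl dot_suml; congr (_ * _).
by apply: eq_bigr => i _; rewrite dot_slotr.
Qed.

Lemma dot_commutator_partial_trace (A : {linear W -> W}) T x y : is_adjoint dot T T ->
  dot (commutator (partial_trace_lin A) T x) y =
  (m%:R^-1 : R)%:C%C * \sum_i dotW (commutator A (ampl m T) (slot i x)) (slot i y).
Proof.
move=> TT; rewrite /commutator dotBl TT !dot_partial_trace -mulrBr -sumrB.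
congr (_ * _); apply: eq_bigr => i _; rewrite dotBl (ampl_slot _ _ TT).
by congr (_ - _); rewrite !dot_slotr ffunE TT.
Qed.

Hypothesis m_gt0 : (0 < m)%N.

Let m_neq0 : m%:R != 0 :> R.
Proof. by rewrite pnatr_eq0 -lt0n. Qed.

Lemma nsq_sum_le (U : lmodType R[i]) (d : {dot U for @conjc R}) k (v : 'I_k -> U) :
  nsq d (\sum_i v i) <= k%:R * \sum_i nsq d (v i).
Proof.
rewrite /nsq dot_suml Re_sum.
apply: (@le_trans _ _ (\sum_(i < k) \sum_(j < k) (nsq d (v i) + nsq d (v j)) / 2)).
  apply: ler_sum => i _; rewrite dot_sumr Re_sum; apply: ler_sum => j _.
  by have := Re_dot_le d (v i) (v j); lra.
rewrite le_eqVlt; apply/orP; left; apply/eqP.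
pose S := \sum_i nsq d (v i).
rewrite (eq_bigr (fun i => (k%:R * nsq d (v i) + S) / 2)).
  by rewrite -mulr_suml big_split -mulr_sumr sumr_const card_ord -mulr_natl /= -/S; field.
by move=> i _; rewrite -mulr_suml big_split sumr_const card_ord /= mulr_natl.
Qed.

Lemma partial_trace_R1plus (A : {linear W -> W}) :
  R1plus dotW A -> R1plus dot (partial_trace_lin A).
Proof.
move=> A1; have [[k [b bA]] A0 _] := A1; split.
- apply: (finite_rank_sum (b := fun p : 'I_m * 'I_k => b p.2 p.1)) => x.
  have [c cE] := choice (fun i => bA (slot i x)).
  exists (fun p => (m%:R^-1 : R)%:C%C * c p.1 p.2).
  rewrite -(pair_bigA _ (fun i j => ((m%:R^-1 : R)%:C%C * c i j) *: (b j : W) i)) /=.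
  rewrite /partial_trace scaler_sumr; apply: eq_bigr => i _.
  rewrite cE sum_ffunE scaler_sumr; apply: eq_bigr => j _.
  by rewrite ffunE scalerA.
- move=> x; rewrite dot_partial_trace mulr_ge0 ?sumr_ge0//.
  by rewrite ler0c invr_ge0.
- move=> x; rewrite le_dotxx /= /partial_trace nsqZ /sqc /= expr0n addr0.
  rewrite -[nsq dot x](mulKf (expf_neq0 2 m_neq0)) -exprVn.
  apply: ler_wpM2l; first exact: sqr_ge0.
  apply: le_trans (nsq_sum_le _ _) _.
  rewrite expr2 -mulrA; apply: ler_wpM2l => //.
  have -> : m%:R * nsq dot x = \sum_(i < m) nsq dot x.
    by rewrite sumr_const card_ord mulr_natl.
  apply: ler_sum => i _; rewrite -(nsq_slot i x).
  apply: le_trans (R1plus_nsq _ A1); rewrite nsq_ampl (bigD1 i)//= lerDl.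
  by apply: sumr_ge0 => j _; exact: nsq_ge0.
Qed.

Lemma op_le_partial_trace (A : {linear W -> W}) B : op_le dotW (ampl_lin B) A ->
  op_le dot B (partial_trace_lin A).
Proof.
move=> BA x; rewrite dot_partial_trace.
have -> : dot (B x) x = (m%:R^-1 : R)%:C%C * \sum_(i < m) dot (B x) x.
  have mm : (m%:R^-1 : R)%:C%C * m%:R = 1 :> R[i].
    by rewrite -(rmorph_nat (real_complex R)) -rmorphM mulVf// rmorph1.
  by rewrite sumr_const card_ord -[dot (B x) x *+ m]mulr_natl mulrA mm mul1r.
apply: ler_wpM2l; first by rewrite ler0c invr_ge0.
apply: ler_sum => i _; apply: le_trans (BA _).
by rewrite ampl_linE dot_slotr !ffunE eqxx.
Qed.

Lemma form_le_partial_trace (A : {linear W -> W}) T delta : is_adjoint dot T T ->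
  form_le dotW (commutator A (ampl m T)) delta ->
  form_le dot (commutator (partial_trace_lin A) T) delta.
Proof.
move=> TT h x y; rewrite (dot_commutator_partial_trace _ _ _ TT) ReZ Re_sum.
rewrite mulrC ler_pdivrMr ?ltr0n//.
set a := delta * _.
have -> : a * m%:R = \sum_(i < m) a by rewrite sumr_const card_ord mulr_natr.
by apply: ler_sum => i _; have := h (slot i x) (slot i y); rewrite !nsq_slot.
Qed.

(** Test [[A, T (x) I]] on the families formed by the copies of [e j] and [f j] in the
    [m] summands.  Setting to 0 the copies of [f j] whose term is negative keeps the
    family Bessel and lets every weight of a block decrease to its last one. *)
Lemma partial_trace_dual_ge (pi t : nat -> R) (A : {linear W -> W}) T c k (e f : 'I_k -> V) :
  (forall i, pi i.+1 <= pi i) -> (forall i, 0 <= pi i) -> is_adjoint dot T T ->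
  bessel dot e -> bessel dot f ->
  (forall j, Re (dot (commutator (partial_trace_lin A) T (e j)) (f j)) = t j) ->
  dual_le dotW pi (commutator A (ampl m T)) c ->
  \sum_(j < k) m%:R * pi (j * m + m.-1)%N * t j <= c.
Proof.
move=> npi pi0 TT be bf tE Tc.
pose r (q : 'I_k * 'I_m) :=
  Re (dotW (commutator A (ampl m T) (slot q.2 (e q.1))) (slot q.2 (f q.1))).
pose e' (l : 'I_(k * m)) := slot (block_index l).2 (e (block_index l).1).
pose f' (l : 'I_(k * m)) := if 0 <= r (block_index l)
  then slot (block_index l).2 (f (block_index l).1) else 0.
have bf' : bessel dotW f' := bessel_restrict (fun l => 0 <= r (block_index l)) (bessel_slot bf).
apply: le_trans (Tc _ e' f' (bessel_slot be) bf').
rewrite [leRHS](eq_bigr (fun l : 'I_(k * m) => (fun q : 'I_k * 'I_m =>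
    pi (q.1 * m + q.2)%N * Num.max 0 (r q)) (block_index l))); last first.
  move=> l _ /=; rewrite -divn_eq /f'; congr (_ * _).
  by case: ifP => [r0|/negbT]; [rewrite (max_r r0)|rewrite -ltNge => /ltW/max_l ->; rewrite dot0r].
rewrite (sum_block_index (fun q => pi (q.1 * m + q.2)%N * Num.max 0 (r q))) /=.
apply: ler_sum => j _; rewrite -tE (dot_commutator_partial_trace _ _ _ TT) ReZ Re_sum.
rewrite [m%:R * _]mulrC -mulrA mulVKf// mulr_sumr; apply: ler_sum => i _.
apply: (@le_trans _ _ (pi (j * m + m.-1)%N * Num.max 0 (r (j, i)))).
  by apply: ler_wpM2l => //; rewrite le_max lexx orbT.
apply: ler_wpM2r; first by rewrite le_max lexx.
apply: (nonincreasing_seqP _).1 npi _ _ _.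
by rewrite leq_add2l -ltnS prednK.
Qed.

End AmpliationGeometry.

(** * Ampliation homogeneity of the quasicentral modulus *)

(** The finitely many indices where [a j <= b j] may fail contribute at most a
    constant times the largest [t j]; the constant does not depend on [t]. *)
Lemma sum_eventually_le (R : realType) (a b : nat -> R) :
  (forall j, 0 <= b j) -> (\forall j \near \oo, a j <= b j) ->
  exists2 K, 0 <= K & forall k (t : nat -> R) (delta : R),
    (forall j : 'I_k, 0 <= t j <= delta) -> 0 <= delta ->
    \sum_(j < k) a j * t j <= \sum_(j < k) b j * t j + K * delta.
Proof.
move=> b0 [J _ abJ]; exists (\sum_(j < J) `|a j|); first exact: sumr_ge0.
move=> k t delta td d0.
apply: (@le_trans _ _ (\sum_(j < k) b j * t j +
    \sum_(j < k | (j < J)%N) `|a j| * delta)).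
  rewrite [X in _ + X]big_mkcond -big_split /=; apply: ler_sum => j _.
  have /andP[t0 tj] := td j; case: ltnP => jJ.
    apply: ler_wpDl; first by rewrite mulr_ge0.
    apply: le_trans (ler_wpM2l (normr_ge0 _) tj); apply: ler_wpM2r => //.
    exact: ler_norm.
  by rewrite addr0; apply: ler_wpM2r => //; exact: abJ.
rewrite lerD2l -mulr_suml; apply: ler_wpM2r => //.
have [kJ|Jk] := leqP k J.
  rewrite (eq_bigl xpredT); last by move=> j; rewrite (leq_trans (ltn_ord j)).
  rewrite (big_ord_widen J (fun j => `|a j|) kJ) big_mkcond /=.
  by apply: ler_sum => j _; case: ifP.
by rewrite (big_ord_widen k (fun j => `|a j|) (ltnW Jk)).
Qed.

Section AmpliationModulus.
Variables (R : realType) (V : lmodType R[i]) (dot : {dot V for @conjc R}).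
Variables (n m : nat) (tau : 'I_n -> V -> V) (pi : nat -> R) (M : R).
Local Notation W := {ffun 'I_m -> V}.
Local Notation dotW := (ampl_dot dot m : {dot W for @conjc R}).
Hypothesis tauA : forall j, is_adjoint dot (tau j) (tau j).
Hypothesis pi_anti : forall i, pi i.+1 <= pi i.
Hypothesis pi_gt0 : forall i, 0 < pi i.
Hypothesis m_gt0 : (0 < m)%N.
Hypothesis M_gt0 : 0 < M.
Hypothesis first_ratio : m%:R * pi (j * m)%N / pi j @[j --> \oo] --> M.
Hypothesis last_ratio : m%:R * pi (j * m + m.-1)%N / pi j @[j --> \oo] --> M.

Let pi_ge0 i : 0 <= pi i. Proof. exact: ltW. Qed.

Let amplA j : is_adjoint dotW (ampl m (tau j)) (ampl m (tau j)).
Proof. exact: ampl_adjoint. Qed.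

Lemma commutator_schmidt (A : {linear V -> V}) j delta : R1plus dot A -> 0 <= delta ->
  form_le dot (commutator A (tau j)) delta ->
  exists k (t : nat -> R) (e f : 'I_k -> V),
  [/\ (forall i, t i.+1 <= t i) /\ (forall i, 0 <= t i),
    schmidt_form dot (commutator A (tau j)) t e f,
    forall i, Re (dot (commutator A (tau j) (e i)) (f i)) = t i &
    forall i : 'I_k, 0 <= t i <= delta].
Proof.
move=> A1 d0 Ad.
have [s Ts] := antiherm_singular_values (commutator_antiherm A1 (tauA j))
  (commutator_finite_rank A1 (tauA j)).
have [t [e [f [[nt t0] TE Tt _ _]]]] := singular_schmidt Ts.
exists (size s), t, e, f; split=> // [i|i]; first by rewrite Tt.
rewrite t0 /=; have [be bf _] := TE.
have := Ad (e i) (f i); rewrite Tt /= => h; apply: le_trans h _.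
have := bessel_nsq i be; have := bessel_nsq i bf.
have := nsq_ge0 dot (e i); have := nsq_ge0 dot (f i).
nra.
Qed.

(** The errors are balanced in this order: [e1] for the ratio of the weights,
    which fixes [K], then the operator norm [delta] small against [K]. *)
Lemma qc_bound_ampl c : 0 <= c -> qc_bound dot tau pi c ->
  qc_bound dotW (fun j => ampl m (tau j)) pi (M * c).
Proof.
move=> c0 qc B B1 eps e0.
(* The cap 1 makes [(M + e1) (c + e1) <= M c + e1 (M + c + 1)]. *)
pose e1 := Num.min 1 (eps / (2 * (M + c + 1))).
have Mc : 0 < M + c + 1 by rewrite ltr_wpDl ?addr_ge0// ltW.
have e10 : 0 < e1 by rewrite lt_min ltr01 divr_gt0// mulr_gt0.
have [e11 e1e] : e1 <= 1 /\ e1 * (M + c + 1) <= eps / 2.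
  split; first by rewrite ge_min lexx.
  have : e1 <= eps / (2 * (M + c + 1)) by rewrite ge_min lexx orbT.
  by rewrite ler_pdivlMr ?mulr_gt0// => h; lra.
have [||K K0 KP] := @sum_eventually_le _ (fun j => m%:R * pi (j * m)%N)
    (fun j => (M + e1) * pi j).
- by move=> j; rewrite mulr_ge0// addr_ge0// ltW.
- have /(cvgr_le M first_ratio) : M < M + e1 by rewrite ltrDl.
  by apply: filterS => j; rewrite ler_pdivrMr.
pose delta := eps / 2 / (K + 1).
have K1 : 0 < K + 1 by rewrite ltr_wpDl.
have d0 : 0 < delta by rewrite !divr_gt0.
have [P PP BP] := R1plus_le_ampl B1.
have [A [A1 PA Ac Ad]] := qc_bound_small tauA pi_gt0 c0 qc
  (finrank_proj_R1plus PP) e10 d0.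
exists (ampl_lin m A); split; first exact: ampl_R1plus.
  by apply: op_le_trans BP _; exact: op_le_ampl.
move=> j k' e' f' be' bf'; rewrite commutator_ampl.
have [k [t [e [f [[nt t0] TE Tt td]]]]] := commutator_schmidt A1 (ltW d0) (Ad j).
apply: le_trans (ampl_dual_le pi_anti pi_ge0 nt t0 m_gt0 TE be' bf') _.
apply: le_trans (KP k t delta td (ltW d0)) _.
have S : \sum_(i < k) (M + e1) * pi i * t i <= (M + e1) * (c + e1).
  rewrite (eq_bigr (fun i : 'I_k => (M + e1) * (pi i * t i))); last first.
    by move=> i _; rewrite mulrA.
  rewrite -mulr_sumr; apply: ler_wpM2l; first by rewrite addr_ge0// ltW.
  have [be bf _] := TE; apply: le_trans (Ac j k e f be bf).
  by apply: ler_sum => i _; rewrite Tt.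
have Kd : K * delta <= eps / 2.
  by rewrite mulrCA ler_piMr ?divr_ge0 ?(ltW e0)// ler_pdivrMr// mul1r lerDl.
apply: le_trans (lerD S Kd) _; nra.
Qed.

(** As in [qc_bound_ampl], the constant [K] is fixed before the operator norm [delta];
    [e1] is chosen so that [(M - e1) (c / M + eps)] exceeds [c] by half of
    [M * eps], which absorbs the two remaining errors. *)
Lemma qc_bound_of_ampl c : 0 <= c ->
  qc_bound dotW (fun j => ampl m (tau j)) pi c -> qc_bound dot tau pi (c / M).
Proof.
move=> c0 qc B B1 eps e0.
have cM : 0 < c / M + eps by rewrite ltr_wpDl// divr_ge0// ltW.
pose e1 := M * eps / (2 * (c / M + eps)).
have e10 : 0 < e1 by rewrite divr_gt0 ?mulr_gt0.
have Mcme : (M - e1) * (c / M + eps) = c + M * eps / 2.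
  have q1 : M * (c / M + eps) = c + M * eps.
    by rewrite mulrDr mulrCA divff ?mulr1// gt_eqF.
  have q2 : e1 * (c / M + eps) = M * eps / 2.
    by rewrite /e1 invfM mulrA -mulrA mulVf ?mulr1// gt_eqF.
  by rewrite mulrBl q1 q2; lra.
have [||K K0 KP] := @sum_eventually_le _ (fun j => (M - e1) * pi j)
    (fun j => m%:R * pi (j * m + m.-1)%N).
- by move=> j; rewrite mulr_ge0.
- have /(cvgr_ge M last_ratio) : M - e1 < M by rewrite ltrBlDr ltrDl.
  by apply: filterS => j; rewrite ler_pdivlMr.
have K1 : 0 < K + 1 by rewrite ltr_wpDl.
pose delta := M * eps / 4 / (K + 1).
have Me : 0 < M * eps / 4 by rewrite divr_gt0 ?mulr_gt0.
have d0 : 0 < delta by rewrite divr_gt0.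
have [A [A1 BA Ac Ad]] := qc_bound_small amplA pi_gt0 c0 qc
  (ampl_R1plus m B1) Me d0.
exists (partial_trace_lin A); split; first exact: partial_trace_R1plus.
  exact: op_le_partial_trace.
move=> j; have TT := tauA j.
have Sd := form_le_partial_trace m_gt0 TT (Ad j).
have [k [t [e [f [[nt t0] TE Tt td]]]]] :=
  commutator_schmidt (partial_trace_R1plus m_gt0 A1) (ltW d0) Sd.
have [be bf _] := TE.
have S := partial_trace_dual_ge m_gt0 pi_anti pi_ge0 TT be bf Tt (Ac j).
have h := KP k t delta td (ltW d0).
move=> k' e' f' be' bf'.
apply: le_trans (schmidt_dual_le pi_anti pi_ge0 nt t0 TE be' bf') _.
have Kd : K * delta <= M * eps / 4.
  by rewrite mulrCA ler_piMr ?(ltW Me)// ler_pdivrMr// mul1r lerDl.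
have Me1 : 0 < M - e1.
  have : 0 < (M - e1) * (c / M + eps) by rewrite Mcme ltr_wpDl// divr_gt0 ?mulr_gt0.
  by rewrite pmulr_lgt0.
rewrite -(ler_pM2l Me1) Mcme mulr_sumr.
rewrite (eq_bigr (fun i : 'I_k => (M - e1) * pi i * t i)); last first.
  by move=> i _; rewrite mulrA.
lra.
Qed.

Lemma qc_modulus_ge0 (U : lmodType R[i]) (d : {dot U for @conjc R}) (T : 'I_n -> U -> U) :
  (0 <= qc_modulus d pi T)%E.
Proof.
have [P PP _] := finrank_proj_span d [::].
apply: le_trans (_ : (0 <= ereal_inf [set tuple_norm d pi (fun i => commutator A (T i))
  | A in [set A | R1plus d A /\ op_le d P A]])%E) _.
  apply: le_ereal_inf_tmp => _ [A _ <-].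
  exact: bigmax_ge_id.
apply: ereal_sup_ubound; exists P => //; exact: finrank_proj_R1plus.
Qed.

Theorem qc_modulus_ampl :
  qc_modulus (ampl_dot dot m) pi (fun j => ampl m (tau j)) =
  (M%:E * qc_modulus dot pi tau)%E.
Proof.
have up c : 0 <= c -> (qc_modulus dot pi tau <= c%:E)%E ->
    (qc_modulus dotW pi (fun j => ampl m (tau j)) <= (M * c)%:E)%E.
  move=> c0 /(qc_modulus_le tauA pi_anti pi_gt0 c0) /(qc_bound_ampl c0) h.
  by apply/(qc_modulus_le amplA pi_anti pi_gt0); rewrite ?mulr_ge0// ltW.
have dn c : 0 <= c -> (qc_modulus dotW pi (fun j => ampl m (tau j)) <= c%:E)%E ->
    (qc_modulus dot pi tau <= (c / M)%:E)%E.
  move=> c0 /(qc_modulus_le amplA pi_anti pi_gt0 c0) /(qc_bound_of_ampl c0) h.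
  by apply/(qc_modulus_le tauA pi_anti pi_gt0); rewrite ?divr_ge0// ltW.
have := qc_modulus_ge0 dot tau.
have := qc_modulus_ge0 dotW (fun j => ampl m (tau j)).
move: up dn; case: (qc_modulus dot _ _) => [a| |]//; case: (qc_modulus dotW _ _) => [b| |]//.
- move=> up dn; rewrite !lee_fin => b0 a0; apply/eqP.
  have := up _ a0 (lexx _); have := dn _ b0 (lexx _); rewrite !lee_fin.
  rewrite -EFinM eqe eq_le ler_pdivlMr// mulrC => -> ->//.
- by move=> up _ _ a0; have := up a a0 (lexx _).
- by move=> _ dn b0 _; have := dn b b0 (lexx _).
- by move=> _ _ _ _; rewrite gt0_muley ?lte_fin.
Qed.

End AmpliationModulus.

(** * Tangents of convex functions *)

Section ConvexDerivative.
Variable R : realType.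
Implicit Types (f F : R -> R).

Lemma is_derive_quotient F (x l : R) : is_derive x 1 F l ->
  h^-1 * (F (x + h) - F x) @[h --> 0^'] --> l.
Proof.
move=> [dF <-]; have -> : (fun h => h^-1 * (F (x + h) - F x)) =
    (fun h => h^-1 *: ((F \o shift x) (h *: 1) - F x)).
  by apply/funext => h /=; rewrite /GRing.scale /= mulr1 [h + x]addrC.
exact: dF.
Qed.

Lemma convex_fun_le f (x y t : R) :
  convex_function (E := R^o) [set` `[0, +oo[] f -> 0 <= x -> 0 <= y ->
  0 <= t <= 1 -> f (x + t * (y - x)) <= f x + t * (f y - f x).
Proof.
move=> cf x0 y0 t01.
have := cf (Itv01 (andP t01).1 (andP t01).2) y x.
rewrite !inE /= !in_itv /= !andbT => /(_ y0 x0); rewrite !convRE /=.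
rewrite /unstable.onem => h; have -> : x + t * (y - x) = t * y + (1 - t) * x by ring.
apply: le_trans h _; rewrite le_eqVlt; apply/orP; left; apply/eqP; ring.
Qed.

(** The chord slope over [[x, x + h]] is monotone in [h]; let [h] tend to 0 from the side
    of [y]. *)
Lemma convex_tangent f (x l y : R) :
  convex_function (E := R^o) [set` `[0, +oo[] f -> is_derive x 1 f l ->
  0 <= x -> 0 <= y -> f x + l * (y - x) <= f y.
Proof.
move=> cf /is_derive_quotient fl x0 y0.
rewrite addrC -lerBrDr.
have [xy|xy|<-] := ltgtP x y; last by rewrite !subrr mulr0.
- have yx : 0 < y - x by rewrite subr_gt0.
  rewrite -ler_pdivlMr//.
  apply: (cvgr_to_le (cvg_dnbhs_at_right fl)); near=> h.
  have h0 : 0 < h by [].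
  have hd : 0 <= h / (y - x) <= 1.
    rewrite divr_ge0 ?(ltW h0) ?(ltW yx)//= ler_pdivrMr// mul1r.
    by near: h; exact: nbhs_right_le.
  have := @convex_fun_le f x y (h / (y - x)) cf x0 y0 hd.
  rewrite divfK ?gt_eqF// => fh.
  rewrite ler_pdivrMl//; lra.
- have yx : y - x < 0 by rewrite subr_lt0.
  rewrite -ler_ndivrMr//.
  apply: (cvgr_to_ge (cvg_dnbhs_at_left fl)); near=> h.
  have h0 : h < 0 by [].
  have hd : 0 <= h / (y - x) <= 1.
    rewrite -mulrNN -invrN divr_ge0 ?oppr_ge0 ?(ltW h0) ?(ltW yx)//=.
    rewrite ler_pdivrMr ?oppr_gt0// mul1r lerN2.
    by near: h; exact: nbhs_left_ge.
  have := @convex_fun_le f x y (h / (y - x)) cf x0 y0 hd.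
  rewrite divfK ?lt_eqF// => fh.
  rewrite ler_ndivlMl//; lra.
Unshelve. all: by end_near. Qed.

End ConvexDerivative.

(** * Regular variation of the weights *)

Section RegularVariation.
Variables (R : realType) (f : gauge R) (s : R).
Hypothesis fRs : property_Rs s f.

Let fconvex : convex_function (E := R^o) [set` `[0, +oo[] f.
Proof. by have [[]] := fRs. Qed.

Let fderivable (x : R) : 0 < x -> derivable f x 1.
Proof. by move=> x0; have [[_ /(_ x x0)[]]] := fRs. Qed.

Let f_is_derive (x : R) : 0 < x -> is_derive x 1 f (derive1 f x).
Proof. by move=> x0; rewrite derive1E; apply/derivableP/fderivable. Qed.

Let f_gt0 (x : R) : 0 < x -> 0 < f x.
Proof. by move=> x0; case: (gaugeP f) => _ _ /(_ x x0). Qed.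

Lemma gauge_lt (x y : R) : 0 <= x -> 0 <= y -> (f x < f y) = (x < y).
Proof.
have [fi _ _ _] := gaugeP f.
move=> x0 y0; apply/idP/idP; last by apply: fi; rewrite in_itv /= ?x0 ?y0.
apply: contraTT; rewrite -!leNgt le_eqVlt => /orP[/eqP ->//|yx].
by apply/ltW/fi => //; rewrite in_itv /= ?x0 ?y0.
Qed.

Lemma gauge_tangent (x y : R) : 0 < x -> 0 <= y ->
  f x + derive1 f x * (y - x) <= f y.
Proof. by move=> x0 y0; apply: convex_tangent => //; [exact: f_is_derive|exact: ltW]. Qed.

Lemma gauge_derive_ge (x : R) : 0 < x -> f x <= x * derive1 f x.
Proof.
move=> x0; have := gauge_tangent x0 (lexx 0); rewrite gauge0; lra.
Qed.

Lemma gauge_derive_gt0 (x : R) : 0 < x -> 0 < derive1 f x.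
Proof.
move=> x0; have := lt_le_trans (f_gt0 x0) (gauge_derive_ge x0).
by rewrite pmulr_rgt0.
Qed.

(** Small values come from the limit at 0, large ones from the tangent at 1, the rest
    from the intermediate value theorem. *)
Lemma gauge_surj (y : R) : 0 < y -> exists2 x, 0 < x & f x = y.
Proof.
move=> y0.
have [a [a0 a1 ay]] : exists a, [/\ 0 < a, a < 1 & f a < y].
  have near_y : \forall a \near 0^'+, [/\ 0 < a, a < 1 & f a < y].
    near=> a; split.
    - by [].
    - by near: a; exact: nbhs_right_lt.
    - by near: a; exact: (cvgr_lt _ (gauge_cvg0 f)).
  by have [a] := filter_ex near_y; exists a.
(* where the tangent at 1 has risen by [y] *)
pose b := 1 + y / derive1 f 1.
have b1 : 1 < b by rewrite ltrDl divr_gt0// gauge_derive_gt0.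
have yb : y <= f b.
  have := @gauge_tangent 1 b ltr01 (ltW (lt_trans ltr01 b1)).
  have -> : derive1 f 1 * (b - 1) = y.
    by rewrite /b addrC addKr mulrCA divff ?mulr1// gt_eqF// gauge_derive_gt0.
  have := f_gt0 ltr01; lra.
have ab : a <= b by apply/ltW/(lt_trans a1).
have fc : {within `[a, b], continuous f}.
  apply: derivable_within_continuous => x; rewrite in_itv /= => /andP[ax _].
  exact: fderivable (lt_le_trans a0 ax).
have [|x] := IVT ab fc (v := y).
  by rewrite ge_min le_max yb (ltW ay) orbT.
rewrite in_itv /= => /andP[ax _] fx; exists x => //; exact: lt_le_trans ax.
Unshelve. all: by end_near. Qed.

Lemma gauge_invK (x : R) : 0 <= x -> gauge_inv f (f x) = x.
Proof.
move=> x0; apply: pinvKV; last by rewrite inE /= in_itv /= x0.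
move=> a b; rewrite !inE /= !in_itv /= !andbT => a0 b0 fab.
case: (ltgtP a b) => // ab; exfalso.
  by have := gauge_lt a0 b0; rewrite ab fab ltxx.
by have := gauge_lt b0 a0; rewrite ab fab ltxx.
Qed.

Lemma gauge_inv_gt0 (y : R) : 0 < y -> 0 < gauge_inv f y.
Proof. by move=> /gauge_surj[x x0 <-]; rewrite gauge_invK// ltW. Qed.

Lemma gauge_invVK (y : R) : 0 < y -> f (gauge_inv f y) = y.
Proof. by move=> /gauge_surj[x x0 <-]; rewrite gauge_invK// ltW. Qed.

Lemma gauge_inv_is_derive (y : R) : 0 < y ->
  is_derive y 1 (gauge_inv f) (derive1 f (gauge_inv f y))^-1.
Proof.
move=> y0; set x := gauge_inv f y; have x0 : 0 < x := gauge_inv_gt0 y0.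
have <- : f x = y := gauge_invVK y0.
apply: is_derive_inverse.
- near=> z; apply: gauge_invK.
  by apply: ltW; near: z; exact: lt_nbhsr.
- near=> z; have z0 : 0 < z by near: z; exact: lt_nbhsr.
  by apply: differentiable_continuous; apply/derivable1_diffP/fderivable.
- exact: f_is_derive.
- by rewrite gt_eqF// gauge_derive_gt0.
Unshelve. all: by end_near. Qed.

(** [d ln f / d ln t]. *)
Definition elasticity (t : R) := t * derive1 f t / f t.

Lemma hgauge_derive (x : R) : 0 < x ->
  derive1 (hgauge f) x =
  (x * gauge_inv f x^-1 * elasticity (gauge_inv f x^-1))^-1.
Proof.
move=> x0; set t := gauge_inv f x^-1.
have t0 : 0 < t by rewrite gauge_inv_gt0 ?invr_gt0.
have x10 : 0 < x^-1 by rewrite invr_gt0.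
have dV : is_derive x 1 (fun z : R => z^-1) (- x ^- 2 *: 1).
  by apply: is_deriveV; rewrite ?gt_eqF.
have dg : is_derive x 1 (gauge_inv f \o (fun z : R => z^-1))
    ((derive1 f t)^-1 * (- x ^- 2 *: 1)).
  exact: is_derive1_comp (gauge_inv_is_derive x10) dV.
have tN0 : (gauge_inv f \o (fun z : R => z^-1)) x != 0 by rewrite gt_eqF.
have [_ dE] := is_deriveV tN0 dg.
rewrite derive1E; apply: (etrans dE); rewrite /elasticity /= -/t.
have -> : f t = x^-1 by exact: gauge_invVK.
rewrite /GRing.scale /=; field.
by rewrite !gt_eqF// gauge_derive_gt0.
Qed.

(** [s] is the derivative of the power function at 1. *)
Lemma powR_quotient_lt (u : R) : s < u -> exists2 a, 1 < a & (a `^ s - 1) < u * (a - 1).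
Proof.
move=> su; have := is_derive_quotient (is_derive1_powR s (@ltr01 R)).
rewrite !powR1 mulr1 => /cvg_dnbhs_at_right/(cvgr_lt s)/(_ u su) h.
have h' : \forall z \near 0^'+, 0 < z /\ z^-1 * ((1 + z) `^ s - 1) < u.
  by near=> z; split => //; near: z.
have [z [z0]] := filter_ex h'.
rewrite ltr_pdivrMl// => zu; exists (1 + z); first by rewrite ltrDl.
by rewrite (_ : 1 + z - 1 = z) 1?mulrC//; ring.
Unshelve. all: by end_near. Qed.

Lemma powR_quotient_gt (u : R) : u < s ->
  exists a, [/\ 0 < a, a < 1 & (a `^ s - 1) < u * (a - 1)].
Proof.
move=> su; have := is_derive_quotient (is_derive1_powR s (@ltr01 R)).
rewrite !powR1 mulr1 => /cvg_dnbhs_at_left/(cvgr_gt s)/(_ u su) h.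
have h' : \forall z \near 0^'-, [/\ z < 0, -1 < z & u < z^-1 * ((1 + z) `^ s - 1)].
  near=> z; split.
  - by [].
  - by near: z; apply: nbhs_left_gt; rewrite oppr_lt0.
  - by near: z.
have [z [z0 z1]] := filter_ex h'.
rewrite ltr_ndivlMl// => zu; exists (1 + z); split; [lra|lra|].
by rewrite (_ : 1 + z - 1 = z) 1?mulrC//; ring.
Unshelve. all: by end_near. Qed.

(** Monotone density for convex functions: chords over [[t, a t]] bound the elasticity
    from above for [a > 1] and from below for [a < 1]. *)
Lemma elasticity_cvg : elasticity t @[t --> 0^'+] --> s.
Proof.
have chord a t : 0 < a -> 0 < t -> (a - 1) * elasticity t <= f (a * t) / f t - 1.
  move=> a0 t0; rewrite /elasticity.
  have := gauge_tangent t0 (ltW (mulr_gt0 a0 t0)) => h.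
  rewrite -subr_ge0.
  have -> : f (a * t) / f t - 1 - (a - 1) * (t * derive1 f t / f t) =
    (f (a * t) - (f t + derive1 f t * (a * t - t))) / f t.
    by field; rewrite gt_eqF// f_gt0.
  by rewrite divr_ge0 ?subr_ge0// ltW// f_gt0.
have [_ fa] := fRs.
apply/cvgrPdist_le => e e0.
have [a a1 aS] := @powR_quotient_lt (s + e) (ltac:(by rewrite ltrDl)).
have [b [b0 b1 bS]] := @powR_quotient_gt (s - e) (ltac:(by rewrite ltrBlDr ltrDl)).
have a0 : 0 < a := lt_trans ltr01 a1.
have ha : \forall t \near 0^'+, f (a * t) / f t < (s + e) * (a - 1) + 1.
  by apply: (cvgr_lt _ (fa a a0)); lra.
have hb : \forall t \near 0^'+, f (b * t) / f t < (s - e) * (b - 1) + 1.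
  by apply: (cvgr_lt _ (fa b b0)); lra.
near=> t; have t0 : 0 < t by [].
have ht : f (a * t) / f t < (s + e) * (a - 1) + 1 by near: t.
have ht' : f (b * t) / f t < (s - e) * (b - 1) + 1 by near: t.
have := chord a t a0 t0; have := chord b t b0 t0.
rewrite ler_distlC => h1 h2; apply/andP; split.
  have : (b - 1) * elasticity t < (b - 1) * (s - e) by lra.
  by rewrite ltr_nM2l ?subr_lt0// => /ltW.
have : (a - 1) * elasticity t < (a - 1) * (s + e) by lra.
by rewrite ltr_pM2l ?subr_gt0// => /ltW.
Unshelve. all: by end_near. Qed.


Hypothesis s_gt0 : 0 < s.

Section AlongSequences.
Variable x : nat -> R.
Hypothesis x_gt0 : forall j, 0 < x j.
Hypothesis x_oo : x j @[j --> \oo] --> +oo.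

Let T j := gauge_inv f (x j)^-1.

Lemma gauge_inv_seq_gt0 j : 0 < T j.
Proof. by apply: gauge_inv_gt0; rewrite invr_gt0. Qed.

Lemma gauge_inv_seq_cvg0 : T j @[j --> \oo] --> (0 : R).
Proof.
apply/cvgrPdist_lt => e e0.
have : \forall j \near \oo, (f e)^-1 < x j by exact: (cvgry_gt x_oo).
apply: filterS => j xj; rewrite sub0r normrN gtr0_norm ?gauge_inv_seq_gt0//.
rewrite -gauge_lt ?(ltW e0)//; last exact/ltW/gauge_inv_seq_gt0.
by rewrite /T gauge_invVK ?invr_gt0// -[ltRHS]invrK ltf_pV2 ?posrE ?invr_gt0 ?f_gt0.
Qed.

Lemma gauge_seq_cvg (phi : R -> R) (l : R) : phi t @[t --> 0^'+] --> l ->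
  phi (T j) @[j --> \oo] --> l.
Proof.
move=> /cvg_at_rightP; apply; split; last exact: gauge_inv_seq_cvg0.
exact: gauge_inv_seq_gt0.
Qed.

End AlongSequences.

Lemma hgauge_derive_gt0 (x : R) : 0 < x -> 0 < derive1 (hgauge f) x.
Proof.
move=> x0; have t0 : 0 < gauge_inv f x^-1 by rewrite gauge_inv_gt0 ?invr_gt0.
rewrite hgauge_derive// invr_gt0 !mulr_gt0 ?invr_gt0 ?f_gt0//.
exact: gauge_derive_gt0.
Qed.

Section TwoSequences.
Variables (x x' : nat -> R) (a : R).
Hypotheses (x_gt0 : forall j, 0 < x j) (x'_gt0 : forall j, 0 < x' j).
Hypotheses (x_oo : x j @[j --> \oo] --> +oo) (x'_oo : x' j @[j --> \oo] --> +oo).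
Hypotheses (a_gt0 : 0 < a) (xx' : x' j / x j @[j --> \oo] --> a).

Let T j := gauge_inv f (x j)^-1.
Let T' j := gauge_inv f (x' j)^-1.

Let T_gt0 j : 0 < T j. Proof. exact: gauge_inv_seq_gt0. Qed.
Let T'_gt0 j : 0 < T' j. Proof. exact: gauge_inv_seq_gt0. Qed.

Let fTT' j : f (T j) / f (T' j) = x' j / x j.
Proof. by rewrite /T /T' !gauge_invVK ?invr_gt0// invrK mulrC. Qed.

(** For [b] on either side of [a^(1/s)], [f (b T') / f T'] tends to [b^s], on the same side
    of [a], while [f T / f T' = x' / x] tends to [a]; monotonicity of [f] then
    compares [T] with [b T']. *)
Lemma gauge_inv_ratio_cvg : T j / T' j @[j --> \oo] --> a `^ s^-1.
Proof.
have [_ fa] := fRs.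
have aK : (a `^ s^-1) `^ s = a by rewrite -powRrM mulVf ?powRr1 ?ltW// gt_eqF.
have m0 : 0 < a `^ s^-1 by rewrite powR_gt0.
apply/cvgrPdist_le => e e0.
have up : \forall j \near \oo, T j / T' j <= a `^ s^-1 + e.
  set b := a `^ s^-1 + e; have b0 : 0 < b by rewrite addr_gt0.
  have ab : a < b `^ s.
    by rewrite -[ltLHS]aK gt0_ltr_powR ?nnegrE ?ltW// ltrDl.
  near=> j.
  have h1 : x' j / x j < (a + b `^ s) / 2.
    by near: j; apply: (cvgr_lt _ xx'); rewrite midf_lt.
  have h2 : (a + b `^ s) / 2 < f (b * T' j) / f (T' j).
    near: j; apply: (cvgr_gt _ (gauge_seq_cvg x'_gt0 x'_oo (fa b b0))).
    by rewrite midf_lt.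
  have := lt_trans h1 h2; rewrite -fTT' ltr_pM2r ?invr_gt0 ?f_gt0//.
  rewrite gauge_lt ?mulr_ge0 ?(ltW b0) ?(ltW (T_gt0 j)) ?(ltW (T'_gt0 j))//.
  by rewrite ler_pdivrMr// => /ltW.
have dn : \forall j \near \oo, a `^ s^-1 - e <= T j / T' j.
  set b := a `^ s^-1 - e; have [b0|b0] := leP b 0.
    by near=> j; apply: le_trans b0 _; rewrite divr_ge0// ltW.
  have ab : b `^ s < a.
    by rewrite -[ltRHS]aK gt0_ltr_powR ?nnegrE ?ltW// ltrBlDr ltrDl.
  near=> j.
  have h1 : (b `^ s + a) / 2 < x' j / x j.
    by near: j; apply: (cvgr_gt _ xx'); rewrite midf_lt.
  have h2 : f (b * T' j) / f (T' j) < (b `^ s + a) / 2.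
    near: j; apply: (cvgr_lt _ (gauge_seq_cvg x'_gt0 x'_oo (fa b b0))).
    by rewrite midf_lt.
  have := lt_trans h2 h1; rewrite -fTT' ltr_pM2r ?invr_gt0 ?f_gt0//.
  rewrite gauge_lt ?mulr_ge0 ?(ltW b0) ?(ltW (T_gt0 j)) ?(ltW (T'_gt0 j))//.
  by rewrite ler_pdivlMr// => /ltW.
by near=> j; rewrite ler_distlC; apply/andP; split; near: j.
Unshelve. all: by end_near. Qed.

Lemma hgauge_derive_ratio_cvg :
  a * derive1 (hgauge f) (x' j) / derive1 (hgauge f) (x j) @[j --> \oo] --> a `^ s^-1.
Proof.
have E : elasticity (T j) / elasticity (T' j) @[j --> \oo] --> s / s.
  apply: cvgM; first exact: gauge_seq_cvg elasticity_cvg.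
  by apply: cvgV; [rewrite gt_eqF|exact: gauge_seq_cvg elasticity_cvg].
have X : a * (x' j / x j)^-1 @[j --> \oo] --> a * a^-1.
  by apply: cvgM; [exact: cvg_cst|apply: cvgV => //; rewrite gt_eqF].
have := cvgM (cvgM X gauge_inv_ratio_cvg) E.
rewrite !divff ?gt_eqF// mulr1 mul1r.
move=> H; apply: (cvg_trans _ (H _ _)); apply: near_eq_cvg; apply: nearW => j /=.
rewrite !hgauge_derive// -/(T j) -/(T' j) /elasticity; field.
by rewrite !gt_eqF// ?f_gt0 ?gauge_derive_gt0.
Qed.

End TwoSequences.

Lemma natr_progression_cvg_pinfty (N k : nat) : (0 < k)%N ->
  ((N + j * k)%N%:R : R) @[j --> \oo] --> +oo.
Proof.
move=> k0; apply/cvgryPge => A.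
have : \forall j \near \oo, A <= j%:R :> R by exact: nbhs_infty_ger.
apply: filterS => j Aj; apply: le_trans Aj _; rewrite ler_nat.
by apply: leq_trans (leq_addl _ _); rewrite leq_pmulr.
Qed.

Lemma hgauge_weights_cvg (N m c : nat) : (0 < N)%N -> (0 < m)%N ->
  m%:R * derive1 (hgauge f) (N + (j * m + c))%:R / derive1 (hgauge f) (N + j)%:R
    @[j --> \oo] --> m%:R `^ s^-1.
Proof.
move=> N0 m0.
have Npos j : 0 < (N + j)%:R :> R by rewrite ltr0n addn_gt0 N0.
have Noo : ((N + j)%:R : R) @[j --> \oo] --> +oo.
  apply: (cvg_trans _ (natr_progression_cvg_pinfty N (ltn0Sn 0))).
  by apply: near_eq_cvg; apply: nearW => j /=; rewrite muln1.
have Nmoo : ((N + (j * m + c))%:R : R) @[j --> \oo] --> +oo.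
  apply: (cvg_trans _ (natr_progression_cvg_pinfty (N + c) m0)).
  by apply: near_eq_cvg; apply: nearW => j /=; rewrite addnAC addnA.
apply: hgauge_derive_ratio_cvg => //; first by rewrite ltr0n.
have inv0 : ((N + j)%:R : R)^-1 @[j --> \oo] --> (0 : R).
  by apply/(gtr0_cvgV0 (f := fun j => (N + j)%:R : R)) => //; exact: nearW.
have : m%:R + (N%:R + c%:R - N%:R * m%:R) * ((N + j)%:R : R)^-1 @[j --> \oo]
    --> (m%:R + (N%:R + c%:R - N%:R * m%:R) * 0 : R).
  by apply: cvgD; [exact: cvg_cst|apply: cvgM; [exact: cvg_cst|]].
rewrite mulr0 addr0 => lin; apply: (cvg_trans _ lin); apply: near_eq_cvg; apply: nearW => j /=.
have := lt0r_neq0 (Npos j).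
by rewrite !natrD natrM => nz; field.
Qed.

End RegularVariation.

(** * Coordinate multiplication operators *)

Section MultiplicationOperators.
Context d (T : measurableType d) (R : realType).
Variable mu : {measure set T -> \bar R}.

Lemma mulop_adjoint (phi : T -> R) (M : R) : measurable_fun setT phi ->
  {ae mu, forall x, `|phi x| <= M} ->
  is_adjoint (L2dot mu) (mulop mu phi) (mulop mu phi).
Proof.
move=> mphi phiM u v; rewrite -(L2class_repr u) -(L2class_repr v).
set g := repr u; set h := repr v.
pose mulfun k := L2Fun (sqintegrable_mul k mphi phiM).
rewrite (mulopE (h := mulfun g) mphi phiM)// (mulopE (h := mulfun h) mphi phiM)//.
apply: (etrans (L2dotE (mulfun g) h)); apply: (etrans _ (esym (L2dotE g (mulfun h)))).
congr cintegral; apply/funext => x /=.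
rewrite -/g -/h; case: (g x) (h x) => [a b] [c e] /=; congr Complex; ring.
Qed.

End MultiplicationOperators.

Lemma tau_mult_adjoint (R : realType) (n : nat)
    (mu : {measure set (borelRn R n) -> \bar R}) (Omega : set (borelRn R n))
    (mOmega : measurable Omega) (j : 'I_n) :
  bounded_set (Omega : set 'rV[R]_n) ->
  is_adjoint (L2dot (mrestr mu mOmega)) (tau_mult mu mOmega j) (tau_mult mu mOmega j).
Proof.
move=> [M [_ OM]]; apply: (@mulop_adjoint _ _ _ _ _ (M + 1)).
  exact: measurable_coord.
exists (~` Omega); split; first exact: measurableC.
  by rewrite /= /mrestr setICl measure0.
move=> x xM Ox; apply: xM; have M1 : M < M + 1 by rewrite ltrDl.
apply: le_trans (OM _ M1 x Ox); rewrite [leRHS]mx_normrE.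
exact: (le_bigmax _ (fun i => `|(x : 'rV[R]_n) i.1 i.2|) (ord0, j)).
Qed.

Theorem theorem4p5 (R : realType) (n : nat) (s : R) (f : gauge R)
    (Omega : set (borelRn R n)) (mOmega : measurable Omega) (N m : nat) :
  1 <= s -> log_concave f -> property_Rs s f ->
  bounded_set (Omega : set 'rV[R]_n) ->
  (0 < hausdorff_measure n f Omega < +oo)%E ->
  (exists C D : R, [/\ 0 < C, 0 < D &
     forall (x : 'rV[R]_n) (r : R), Omega x -> 0 < r <= ediam Omega ->
       ((C * f r)%:E <= hausdorff_measure n f (eball x r `&` Omega)
                     <= (D * f r)%:E)%E]) ->
  (0 < N)%N ->
  (forall k, (N <= k)%N ->
     derive1 (hgauge f) k.+1%:R <= derive1 (hgauge f) k%:R) ->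
  (0 < m)%N ->
  let rho (j : nat) : R := derive1 (hgauge f) (N + j)%:R in
  let dot := L2dot (mrestr (hausdorff_measure n f) mOmega) in
  let tau := tau_mult (hausdorff_measure n f) mOmega in
  qc_modulus (ampl_dot dot m) rho (fun j => ampl m (tau j)) =
  ((m%:R `^ s^-1)%:E * qc_modulus dot rho tau)%E.
Proof.
move=> s1 _ fRs bOmega _ _ N0 hN m0 rho dot tau.
have s0 : 0 < s := lt_le_trans ltr01 s1.
apply: qc_modulus_ampl => //.
- by move=> j; exact: tau_mult_adjoint.
- by move=> j; rewrite /rho addnS; apply: hN; exact: leq_addr.
- by move=> j; apply: (hgauge_derive_gt0 fRs); rewrite ltr0n addn_gt0 N0.
- by rewrite powR_gt0// ltr0n.
- apply: (cvg_trans _ (hgauge_weights_cvg fRs s0 0 N0 m0)).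
  by apply: near_eq_cvg; apply: nearW => j; rewrite /rho addn0.
- exact: (hgauge_weights_cvg fRs s0 m.-1 N0 m0).
Qed.
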